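(* Let $N\ge 1$, $\rho>0$ and let $f\in C^1([0,\infty))$ satisfy $f(s)>0$ and $f'(s)>0$ for all $s\in(0,\infty)$, and $F(s):=\int_s^\infty \frac{du}{f(u)}<\infty$ for all $s>0$. Assume that the limit $A=\lim_{s\to\infty}f'(s)F(s)$ exists. Furthermore, assume that $A-1<N/2$ and that there exists a constant $s_2>0$ such that $f'(s)F(s)\ge A$ for all $s\ge s_2$. Then, for any $r\in[A-1,N/2)$ if $A>1$, or any $r\in(0,N/2)$ if $A=1$, there exists a nonnegative measurable initial function $u_0$ satisfying $F(u_0)^{-r}\in L^1_{ul,\rho}(\mathbb{R}^N)$ such that for no $T>0$ does there exist a nonnegative classical solution $u\in C^{2,1}(\mathbb{R}^N\times(0,T))$ of $$\partial_t u=\Delta u+f(u)\ \text{ in }\mathbb{R}^N\times(0,T),\qquad u(x,0)=u_0(x)\ \text{ in }\mathbb{R}^N,$$ satisfying the initial condition in the sense $$\lim_{t\to0}\|u(t)-e^{t\Delta}u_0\|_{L^{\frac{r}{A-1}}_{ul,\rho}(\mathbb{R}^N)}=0\quad\text{if }A>1,\qquad \lim_{t\to0}\|u(t)-e^{t\Delta}u_0\|_{L^\infty(\mathbb{R}^N)}=0\quad\text{if }A=1 .$$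
   Context: $F(s)^{-r}$ means $(F(s))^{-r}$; $F(0):=\int_0^\infty du/f(u)\in(0,\infty]$, with $F(0)^{-r}=0$ if $F(0)=\infty$. For $y\in\mathbb{R}^N$, $B_\rho(y)$ is the ball of radius $\rho$ centered at $y$. For $1\le p<\infty$, $L^p_{ul,\rho}(\mathbb{R}^N)$ is the space of $u\in L^p_{loc}(\mathbb{R}^N)$ with $\|u\|_{L^p_{ul,\rho}(\mathbb{R}^N)}:=\sup_{y\in\mathbb{R}^N}\left(\int_{B_\rho(y)}|u(x)|^p\,dx\right)^{1/p}<\infty$. $(e^{t\Delta}\varphi)(x):=(4\pi t)^{-N/2}\int_{\mathbb{R}^N}e^{-|x-y|^2/(4t)}\varphi(y)\,dy$. $C^{2,1}(\mathbb{R}^N\times(0,T))$ denotes functions that are $C^2$ in $x$ and $C^1$ in $t$. A classical solution satisfies the equation pointwise in $\mathbb{R}^N\times(0,T)$, the initial condition being understood in the sense of the stated limit. *)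

(* Defs.v *)
From HB Require Import structures.
From mathcomp Require Import all_boot all_order all_algebra.
From mathcomp Require Import all_classical all_reals all_analysis.
From mathcomp Require Import measurable_realfun ess_sup_inf.

Set Implicit Arguments.
Unset Strict Implicit.
Unset Printing Implicit Defensive.
Import Order.TTheory GRing.Theory Num.Theory.
Import numFieldNormedType.Exports.
Local Open Scope classical_set_scope.
Local Open Scope ring_scope.

Definition rV_coord (R : realType) (n : nat) (i : 'I_n) (v : 'rV[R]_n) :
  measurableTypeR R := v ord0 i.

Section rV_measurable.
Context {R : realType} {n : nat}.

Let rV_set0 : g_sigma_preimage (@rV_coord R n) set0.
Proof. exact: sigma_algebra0. Qed.

Let rV_setC A : g_sigma_preimage (@rV_coord R n) A ->
  g_sigma_preimage (@rV_coord R n) (~` A).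
Proof. exact: sigma_algebraC. Qed.

Let rV_bigcup (F : (set 'rV[R]_n)^nat) :
  (forall i, g_sigma_preimage (@rV_coord R n) (F i)) ->
  g_sigma_preimage (@rV_coord R n) (\bigcup_i (F i)).
Proof. exact: sigma_algebra_bigcup. Qed.

(* The sigma-algebra generated by the coordinates, i.e. the Borel
   sigma-algebra of R^n. *)
HB.instance Definition _ := @isMeasurable.Build default_measure_display
  'rV[R]_n (g_sigma_preimage (@rV_coord R n)) rV_set0 rV_setC rV_bigcup.

End rV_measurable.

Lemma measurable_rV_coord (R : realType) (n : nat) (i : 'I_n) :
  measurable_fun [set: 'rV[R]_n] (rV_coord i).
Proof.
move=> _ Y mY; rewrite setTI; apply: sub_sigma_algebra => /=.
rewrite -bigcup_seq/=; exists i => /=; first by rewrite mem_index_enum.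
by exists Y => //; rewrite setTI.
Qed.

Lemma measurable_fun_rV (d : measure_display) (T : measurableType d)
    (R : realType) (n : nat) (f : T -> 'rV[R]_n) :
  (forall i, measurable_fun [set: T] (rV_coord i \o f)) ->
  measurable_fun [set: T] f.
Proof.
move=> mf.
suff H : preimage_set_system [set: T] f (g_sigma_preimage (@rV_coord R n))
   `<=` measurable by move=> _ A mA; apply: H; exists A.
rewrite -g_sigma_preimage_comp.
apply: smallest_sub; first exact: sigma_algebra_measurable.
move=> A; rewrite -bigcup_seq => -[i _ [B mB <-]]; exact: mf.
Qed.

Definition rV_cons (R : realType) (n : nat) (p : measurableTypeR R * 'rV[R]_n) :
  'rV[R]_n.+1 := \row_i oapp (fun j => p.2 ord0 j) p.1 (unlift ord0 i).

Definition rV_uncons (R : realType) (n : nat) (v : 'rV[R]_n.+1) :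
  measurableTypeR R * 'rV[R]_n := (v ord0 ord0, \row_j v ord0 (lift ord0 j)).

Lemma rV_consK (R : realType) (n : nat) : cancel (@rV_cons R n) (@rV_uncons R n).
Proof.
move=> [x v]; congr pair; first by rewrite mxE unlift_none.
by apply/rowP => j; rewrite !mxE liftK.
Qed.

Lemma measurable_rV_cons (R : realType) (n : nat) :
  measurable_fun setT (@rV_cons R n).
Proof.
apply: measurable_fun_rV => i.
case: (unliftP ord0 i) => [j ->|->].
  rewrite (_ : _ \o _ = rV_coord j \o snd).
    by apply: measurableT_comp => //; exact: measurable_rV_coord.
  by apply/funext => p; rewrite /= /rV_coord mxE liftK.
rewrite (_ : _ \o _ = fst) //.
by apply/funext => p; rewrite /= /rV_coord mxE unlift_none.
Qed.

Lemma measurable_rV_uncons (R : realType) (n : nat) :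
  measurable_fun setT (@rV_uncons R n).
Proof.
apply/measurable_fun_pairP; split; first exact: measurable_rV_coord.
apply: measurable_fun_rV => j.
rewrite (_ : _ \o _ = rV_coord (lift ord0 j)); first exact: measurable_rV_coord.
by apply/funext => v; rewrite /= /rV_coord mxE.
Qed.

Section lebesgue_rV_step.
Context {R : realType} {n : nat}.
Variable mu : {sigma_finite_measure set 'rV[R]_n -> \bar R}.

Let lmu : {measure set (measurableTypeR R * 'rV[R]_n)%type -> \bar R} :=
  (@lebesgue_measure R \x mu)%E.

Definition rV_step : set 'rV[R]_n.+1 -> \bar R :=
  pushforward (@lebesgue_measure R \x mu)%E (@rV_cons R n).

Let rV_step0 : rV_step set0 = 0%E.
Proof. by rewrite /rV_step /pushforward preimage_set0 measure0. Qed.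

Let rV_step_ge0 A : (0 <= rV_step A)%E.
Proof. exact: (measure_ge0 lmu). Qed.

Let rV_step_sigma_additive : semi_sigma_additive rV_step.
Proof.
move=> F mF tF mUF; rewrite /rV_step /pushforward preimage_bigcup.
have mc B : measurable B -> measurable (@rV_cons R n @^-1` B).
  by move=> mB; rewrite -[X in measurable X]setTI; exact: measurable_rV_cons.
apply: (@measure_semi_sigma_additive _ _ _ lmu
  (fun k => @rV_cons R n @^-1` F k)).
- by move=> i; exact: mc.
- apply/trivIsetP => /= i j _ _ ij; rewrite -preimage_setI.
  by move/trivIsetP : tF => /(_ _ _ _ _ ij) ->//; rewrite preimage_set0.
- by rewrite -preimage_bigcup; exact: mc.
Qed.

HB.instance Definition _ := isMeasure.Build _ _ _
  rV_step rV_step0 rV_step_ge0 rV_step_sigma_additive.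

Let rV_step_sigma_finite : sigma_finite setT rV_step.
Proof.
have /sigma_finiteP[F [TF ndF Foo]] := sigma_finiteT (@lebesgue_measure R).
have /sigma_finiteP[G [TG ndG Goo]] := sigma_finiteT mu.
exists (fun k => @rV_uncons R n @^-1` (F k `*` G k)).
  apply/seteqP; split => // v _.
  have [i _ Fi] : (\bigcup_i F i) (rV_uncons v).1 by rewrite -TF.
  have [j _ Gj] : (\bigcup_i G i) (rV_uncons v).2 by rewrite -TG.
  exists (maxn i j) => //; split.
    by move: Fi; exact/subsetPset/ndF/leq_maxl.
  by move: Gj; exact/subsetPset/ndG/leq_maxr.
move=> k; have [mF Fk] := Foo k; have [mG Gk] := Goo k; split.
  rewrite -[X in measurable X]setTI; apply: measurable_rV_uncons => //.
  exact: measurableX.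
rewrite /rV_step /pushforward -comp_preimage.
rewrite (_ : _ \o _ = id); last by apply/funext => p; exact: rV_consK.
by rewrite preimage_id product_measure1E// lte_mul_pinfty// ge0_fin_numE.
Qed.

HB.instance Definition _ := Measure_isSigmaFinite.Build _ _ _
  rV_step rV_step_sigma_finite.

End lebesgue_rV_step.

Fixpoint lebesgue_rV (R : realType) (n : nat) :
    {sigma_finite_measure set 'rV[R]_n -> \bar R} :=
  if n is m.+1 then @rV_step R m (lebesgue_rV R m) else \d_(0 : 'rV[R]_0).

Lemma lebesgue_rV_box (R : realType) (n : nat) (A : 'I_n -> set R) :
  (forall i, measurable (A i : set (measurableTypeR R))) ->
  lebesgue_rV R n [set v | forall i, A i (v ord0 i)] =
    (\prod_(i < n) lebesgue_measure (A i))%E.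
Proof.
elim: n A => [|n IH] A mA.
  by rewrite big_ord0 /= diracE mem_set//= => -[].
rewrite big_ord_recl -IH; last by move=> i; exact: mA.
rewrite /= /rV_step /pushforward.
set B := [set v : 'rV[R]_n | forall i, A (lift ord0 i) (v ord0 i)].
have mB : measurable B.
  rewrite (_ : B = \bigcap_(i in [set: 'I_n]) (rV_coord i @^-1` A (lift ord0 i))).
    apply: fin_bigcap_measurable => [|i _]; first exact: finite_finset.
    rewrite -[X in measurable X]setTI.
    exact: measurable_rV_coord.
  by apply/seteqP; split => v /= Hv i; [move=> _; exact: Hv|exact: Hv i I].
rewrite -product_measure1E//; congr ((_ \x _)%E _).
apply/seteqP; split => [[x v] /= H|[x v] /= [Hx Hv] i].
  split => [|i].
    by have := H ord0; rewrite mxE unlift_none.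
  by have := H (lift ord0 i); rewrite mxE liftK.
by rewrite mxE; case: (unliftP ord0 i) => [j ->|->] //=; exact: Hv.
Qed.

(* The library norm on ['rV[R]_n] is the sup norm; balls are Euclidean here. *)
Definition enorm (R : realType) (n : nat) (x : 'rV[R]_n) : R :=
  Num.sqrt (\sum_(i < n) x ord0 i ^+ 2).

Definition eball (R : realType) (n : nat) (y : 'rV[R]_n) (rho : R) :
  set 'rV[R]_n := [set x | enorm (x - y) < rho].

Definition ul_norm (R : realType) (n : nat) (rho p : R)
    (g : 'rV[R]_n -> \bar R) : \bar R :=
  ereal_sup [set ((\int[lebesgue_rV R n]_(x in eball y rho) (`|g x| `^ p))
    `^ p^-1)%E | y in [set: 'rV[R]_n]].

(* Finiteness of the norm subsumes local p-integrability. *)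
Definition in_Lul (R : realType) (n : nat) (rho p : R)
    (g : 'rV[R]_n -> \bar R) : Prop :=
  measurable_fun setT g /\ (ul_norm rho p g < +oo)%E.

(* [Lnorm] at [+oo] is the essential supremum of the absolute value. *)
Definition Linfty_norm (R : realType) (n : nat) (g : 'rV[R]_n -> \bar R) :
  \bar R := Lnorm (lebesgue_rV R n) +oo%E g.

(* One-sided at 0: only the values of [f] on [0, +oo[ matter. *)
Definition C1_halfline (R : realType) (f : R -> R) : Prop :=
  exists df : R -> R,
    (forall s, 0 <= s ->
       (f y - f s) / (y - s) @[y --> within (fun y => 0 <= y) s^'] --> df s) /\
    {within `[0, +oo[, continuous df}.

Definition F_tail (R : realType) (f : R -> R) (s : R) : \bar R :=
  (\int[lebesgue_measure]_(u in `]s, +oo[) ((f u)^-1)%:E)%E.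

(* [F(s)^{-r}] for [r > 0]. Written as an inverse because the library has
   [+oo `^ (- r) = +oo], whereas [(+oo `^ r)^-1 = 0]. *)
Definition F_negpow (R : realType) (f : R -> R) (r s : R) : \bar R :=
  ((F_tail f s `^ r)^-1)%E.

(* Extended-real valued: for [phi >= 0] it equals [+oo] exactly where the
   integral diverges. *)
Definition heat (R : realType) (n : nat) (t : R) (phi : 'rV[R]_n -> R)
    (x : 'rV[R]_n) : \bar R :=
  (((4 * pi * t) `^ (- (n%:R / 2)))%:E *
   \int[lebesgue_rV R n]_y
     (expR (- (enorm (x - y) ^+ 2 / (4 * t))) * phi y)%:E)%E.

Definition partial (R : realType) (n : nat) (i : 'I_n) (g : 'rV[R]_n -> R) :
  'rV[R]_n -> R := fun x => 'D_(delta_mx ord0 i) g x.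

Definition laplacian (R : realType) (n : nat) (g : 'rV[R]_n -> R)
    (x : 'rV[R]_n) : R := \sum_(i < n) partial i (partial i g) x.

(* [u t x] is the value at time [t] and position [x]. The function, its first
   time derivative and its space derivatives of order at most two exist and are
   jointly continuous on R^n x ]0, T[. *)
Definition C21 (R : realType) (n : nat) (T : R) (u : R -> 'rV[R]_n -> R) :
  Prop :=
  let D := [set z : 'rV[R]_n * R | 0 < z.2 < T] in
  (forall x t, 0 < t < T ->
     [/\ derivable (u ^~ x) t 1,
         forall i, derivable (u t) x (delta_mx ord0 i) &
         forall i j, derivable (partial i (u t)) x (delta_mx ord0 j)]) /\
  [/\ {in D, continuous (fun z => u z.2 z.1)},
      {in D, continuous (fun z => derive1 (u ^~ z.1) z.2)},
      forall i, {in D, continuous (fun z => partial i (u z.2) z.1)} &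
      forall i j, {in D, continuous (fun z =>
        partial j (partial i (u z.2)) z.1)}].

Definition nonneg_classical_solution (R : realType) (n : nat) (f : R -> R)
    (T : R) (u : R -> 'rV[R]_n -> R) : Prop :=
  [/\ C21 T u,
      forall x t, 0 < t < T -> 0 <= u t x &
      forall x t, 0 < t < T ->
        derive1 (u ^~ x) t = laplacian (u t) x + f (u t x)].

Definition heat_error (R : realType) (n : nat) (u : R -> 'rV[R]_n -> R)
    (u0 : 'rV[R]_n -> R) (t : R) (x : 'rV[R]_n) : \bar R :=
  ((u t x)%:E - heat t u0 x)%E.

(* Main.v *)
Require Import Defs.
From mathcomp Require Import all_boot all_order all_algebra.
From mathcomp Require Import all_classical all_reals all_analysis.
From mathcomp Require Import measurable_realfun ess_sup_inf.
From mathcomp Require Import ring lra.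

Set Implicit Arguments.
Unset Strict Implicit.
Unset Printing Implicit Defensive.
Import Order.TTheory GRing.Theory Num.Theory.
Import numFieldNormedType.Exports.
Local Open Scope classical_set_scope.
Local Open Scope ring_scope.

(** Why existence fails.  Put [F s] for the integral of [1 / f] over [s, +oo[,
    and fix [theta < 1] with [r < theta * N / 2].  The initial function is supported
    in disjoint cubes marching to infinity; on the [k]-th one it is a constant
    above [c_k], where [F c_k] tends to zero.  The half-width of the cube is
    [2 * l_k], where [l_k ^ 2 = F c_k ^ theta].  The exponent [theta] balances
    two requirements.
    - Since [theta * N / 2 > r], the contribution [F c_k ^ (- r) * l_k ^ N] of
      the [k]-th cube to the integral of [F(u0) ^ (- r)] is as small as desired,
      so [F(u0) ^ (- r)] is uniformly locally integrable.
    - Since [theta < 1], the cube is wide on the time scale [F c_k] on which the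
      equation without diffusion blows up from [c_k]: diffusion through a cube
      of that size has rate [l_k ^ (- 2)], and [l_k ^ (- 2) * y] is negligible
      against [f y] for all [y >= c_k] ([fF_superlinear]).

    Let [u] be a solution up to time [T], and let [y] be its spatial mean on the
    [k]-th cube, weighted by a product of cosine arches, the first Dirichlet
    eigenfunction of a cube extended by zero.  Two facts give a differential
    inequality for [y].
    - The weight [phi] satisfies [Delta phi >= - N * l ^ (- 2) * phi] weakly on
      the whole space, hence the mean of [Delta u] is at least
      [- N * l ^ (- 2) * y] ([bumpI_partial2]).  Integration by parts is carried
      out on second difference quotients, where it is nothing but translation
      invariance of Lebesgue measure.
    - The function [f] may fail to be convex, but the hypotheses confine [f'] to
      the interval from [A / F] to [2 * A / F] for large arguments, and [1 / F]
      is increasing; so at every large [y] some line through [(y, f y / 4)] lies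
      below [f] ([supporting_line]), which is what Jensen's inequality uses.
    Hence [y' >= f y / 4 - N * l ^ (- 2) * y >= f y / 8] as soon as [y >= c_k],
    so [F(y)] decreases at rate at least [1 / 8] and the solution lives at most
    [8 * F c_k] longer ([solution_lifespan_le]).

    It remains to see that [y >= c_k] at arbitrarily small times.  Convergence
    of [u t - heat t u0] to zero, uniformly or in a uniformly local Lebesgue
    space, implies convergence in measure on a ball around the cube
    ([eventually_small]), and [heat t u0] tends to at least the plateau value
    inside the cube ([heat_ge]); as that value exceeds [c_k], the mean of [u t]
    is at least [c_k] for some small [t] ([initial_mean_ge]).  So
    [T / 4 <= 8 * F c_k] for every [k], whereas [F c_k] tends to zero. *)

(** * Borel functions and translation invariance on row vectors *)

Lemma rV_cons_add (R : realType) (n : nat) (p q : measurableTypeR R * 'rV[R]_n) :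
  rV_cons p + rV_cons q = rV_cons (p.1 + q.1 : R, p.2 + q.2).
Proof.
apply/rowP => i; rewrite !mxE.
by case: (unliftP ord0 i) => [j|] _ //=; rewrite mxE.
Qed.

Lemma rV_unconsK (R : realType) (n : nat) : cancel (@rV_uncons R n) (@rV_cons R n).
Proof.
move=> v; apply/rowP => i; rewrite !mxE.
by case: (unliftP ord0 i) => [j ->|->] //=; rewrite mxE.
Qed.

Lemma measurable_rV_add (R : realType) (n : nat) (h : 'rV[R]_n) :
  measurable_fun setT (fun x : 'rV[R]_n => x + h).
Proof.
apply: measurable_fun_rV => i.
rewrite (_ : _ \o _ = (fun x => rV_coord i x + h ord0 i)); last first.
  by apply/funext => x; rewrite /= /rV_coord mxE.
by apply: measurable_funD => //; exact: measurable_rV_coord.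
Qed.

Lemma rV_norm_lt (R : realType) (n : nat) (x : 'rV[R]_n) (e : R) : 0 < e ->
  (`|x| < e) = [forall i, `|x ord0 i| < e].
Proof.
move=> e0; rewrite /Num.norm/= mx_normrE; apply/idP/forallP => [|xe].
  by move=> /bigmax_ltP[_ xe] i; exact: (xe (ord0, i)).
apply/bigmax_ltP; split => // -[j i] _ /=; rewrite (ord1 j); exact: xe.
Qed.

Lemma measurable_rV_box (R : realType) (n : nat) (A : 'I_n -> set R) :
  (forall i, measurable (A i : set (measurableTypeR R))) ->
  measurable [set v : 'rV[R]_n | forall i, A i (v ord0 i)].
Proof.
move=> mA.
rewrite (_ : mkset _ = \bigcap_(i in [set: 'I_n]) (rV_coord i @^-1` A i)).
  apply: fin_bigcap_measurable => [|i _]; first exact: finite_finset.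
  by rewrite -[X in measurable X]setTI; exact: measurable_rV_coord.
by apply/seteqP; split => v /= Hv i; [move=> _; exact: Hv|exact: Hv i I].
Qed.

Lemma measurable_rV_ball (R : realType) (n : nat) (p : 'rV[R]_n) (e : R) :
  measurable [set x : 'rV[R]_n | `|x - p| < e].
Proof.
have [e0|e0] := ltP 0 e; last first.
  rewrite (_ : mkset _ = set0); first exact: measurable0.
  by apply/seteqP; split => x //= /(le_lt_trans (normr_ge0 _)); rewrite ltNge e0.
rewrite (_ : mkset _ = [set x : 'rV[R]_n | forall i : 'I_n,
   `]p ord0 i - e, p ord0 i + e[%classic (x ord0 i)]).
  apply: (@measurable_rV_box R n
    (fun i => `]p ord0 i - e, p ord0 i + e[%classic)) => i.
  exact: measurable_itv.
apply/seteqP; split => x /=; rewrite rV_norm_lt//.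
  by move=> /forallP xe i; have := xe i; rewrite !mxE ltr_distl in_itv.
by move=> xe; apply/forallP => i; have := xe i; rewrite !mxE ltr_distl in_itv.
Qed.

(** Balls of the sup norm are boxes, and an open set is the union of the
    countably many balls with rational centre and radius [1 / m] inside it. *)
Lemma open_measurable_rV (R : realType) (n : nat) (U : set 'rV[R]_n) :
  open U -> measurable U.
Proof.
move=> oU.
pose B (k : 'rV[rat]_n * nat) : set 'rV[R]_n :=
  [set x | `|x - map_mx ratr k.1| < k.2.+1%:R^-1].
rewrite (_ : U = \bigcup_k (if `[< B k `<=` U >] then B k else set0)).
  apply: countable_bigcupT_measurable => [|k]; first exact: countableP.
  by case: asboolP => _ //; exact: measurable_rV_ball.
apply/seteqP; split => [x Ux|x [k _]]; last by case: asboolP => // BU; exact: BU.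
have [e /= e0 xe] := (nbhs_ballP _ _).1 (open_nbhs_nbhs (conj oU Ux)).
have [m me] : exists m : nat, 2 * m.+1%:R^-1 < e.
  exists (Num.truncn (2 / e)); rewrite -ltr_pdivlMr ?invr_gt0 ?ltr0n//.
  by rewrite invrK -ltr_pdivrMl// mulrC truncnS_gt.
have m0 : 0 < m.+1%:R^-1 :> R by rewrite invr_gt0.
have q_ i : {q : rat | `|x ord0 i - ratr q| < m.+1%:R^-1}.
  apply: cid; have [q] := @rat_in_itvoo R (x ord0 i - m.+1%:R^-1)
    (x ord0 i + m.+1%:R^-1) ltac:(by rewrite ltrBlDr -addrA ltrDl addr_gt0).
  by rewrite in_itv/= => xq; exists q; rewrite distrC ltr_distl.
pose q : 'rV[rat]_n := \row_i sval (q_ i).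
have xq : B (q, m) x.
  rewrite /B/= rV_norm_lt//; apply/forallP => i; rewrite !mxE.
  exact: (svalP (q_ i)).
exists (q, m) => //; case: asboolP => // -[] y yB; apply: xe.
rewrite -ball_normE/=.
rewrite (_ : x - y = (x - map_mx ratr q) - (y - map_mx ratr q)); last first.
  by rewrite opprB addrA subrK.
rewrite (le_lt_trans (ler_normB _ _))// (lt_trans _ me)// mulr_natl mulr2n.
exact: ltrD.
Qed.

Lemma continuous_measurable_rV (R : realType) (n : nat) (g : 'rV[R]_n -> R) :
  continuous g -> measurable_fun setT g.
Proof.
move=> /continuousP cg; apply: (measurability _ (RGenOpens.measurableE R)).
move=> _ [_ [a [b ->] <-]]; rewrite setTI; apply: open_measurable_rV.
exact/cg/interval_open.
Qed.

Lemma ge0_integral_addr (R : realType) (h : R) (g : R -> \bar R) :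
  measurable_fun [set: measurableTypeR R] g -> (forall x, 0 <= g x)%E ->
  (\int[lebesgue_measure]_x g (x + h)%R = \int[lebesgue_measure]_x g x)%E.
Proof.
move=> mg g0.
pose sh : measurableTypeR R -> measurableTypeR R := fun x : R => x + h.
have mh : measurable_fun [set: measurableTypeR R] sh.
  by apply: measurable_funD => //; exact: measurable_cst.
transitivity (\int[pushforward lebesgue_measure
    sh]_x g x)%E.
  by rewrite ge0_integral_pushforward//= => x _; exact: g0.
apply: eq_measure_integral => //= A mA _; apply/esym/lebesgue_measure_unique => //=.
move=> _ [[a b]] _ <-; rewrite /pushforward.
rewrite (_ : _ @^-1` _ = `]a - h, b - h]%classic); last first.
  apply/seteqP; split => x /=; rewrite !in_itv/=;
  by rewrite -lerBrDr -ltrBlDr.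
by rewrite !lebesgue_measure_itv/= !lte_fin ltrD2r -!EFinD opprB addrA subrK.
Qed.

(** Tonelli's theorem through the recursive construction of the measure. *)
Lemma ge0_integral_rV_succ (R : realType) (n : nat) (g : 'rV[R]_n.+1 -> \bar R) :
  measurable_fun setT g -> (forall x, 0 <= g x)%E ->
  (\int[lebesgue_rV R n.+1]_x g x =
   \int[lebesgue_measure]_x \int[lebesgue_rV R n]_v g (rV_cons (x, v)))%E.
Proof.
move=> mg g0.
transitivity (\int[pushforward (@lebesgue_measure R \x lebesgue_rV R n)
   (@rV_cons R n)]_x g x)%E; first by [].
rewrite ge0_integral_pushforward//; last exact: measurable_rV_cons.
rewrite preimage_setT fubini_tonelli1//=.
exact: (measurableT_comp mg (@measurable_rV_cons R n)).
Qed.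

Lemma measurable_integral_rV_cons (R : realType) (n : nat)
    (g : 'rV[R]_n.+1 -> \bar R) :
  measurable_fun setT g -> (forall x, 0 <= g x)%E ->
  measurable_fun [set: measurableTypeR R]
    (fun x => \int[lebesgue_rV R n]_v g (rV_cons (x, v)))%E.
Proof.
move=> mg g0.
apply: (@measurable_fun_fubini_tonelli_F _ _ _ _ _ (lebesgue_rV R n)
  (g \o @rV_cons R n)) => //.
exact: (measurableT_comp mg (@measurable_rV_cons R n)).
by move=> x; exact: g0.
Qed.

(** Peeling off the first coordinate reduces translation invariance to the
    line. *)
Lemma ge0_integral_rV_add (R : realType) (n : nat) (h : 'rV[R]_n)
    (g : 'rV[R]_n -> \bar R) :
  measurable_fun setT g -> (forall x, 0 <= g x)%E ->
  (\int[lebesgue_rV R n]_x g (x + h)%R = \int[lebesgue_rV R n]_x g x)%E.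
Proof.
elim: n h g => [|n IH] h g mg g0.
  by apply: eq_integral => x _; congr g; apply/rowP => -[].
have mgh : measurable_fun setT (fun x : 'rV[R]_n.+1 => g (x + h)).
  exact: (measurableT_comp mg (measurable_rV_add h)).
rewrite (ge0_integral_rV_succ mg g0).
rewrite (ge0_integral_rV_succ mgh (fun x => g0 (x + h))).
have -> : h = rV_cons (rV_uncons h) by rewrite rV_unconsK.
case: (rV_uncons h) => h0 h'.
rewrite -[RHS](@ge0_integral_addr R h0); first last.
- by move=> x; exact: integral_ge0.
- exact: measurable_integral_rV_cons.
apply: eq_integral => x _.
rewrite -(IH h' (fun v => g (rV_cons ((x + h0)%R, v)))).
- by apply: eq_integral => v _; rewrite rV_cons_add.
- apply: (measurableT_comp mg).
  exact: (measurableT_comp (@measurable_rV_cons R n) (pair1_measurable _)).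
- by move=> v; exact: g0.
Qed.

(** * Lower bounds for the heat semigroup *)

Lemma enorm_sqr (R : realType) (n : nat) (x : 'rV[R]_n) :
  enorm x ^+ 2 = \sum_(i < n) x ord0 i ^+ 2.
Proof. by rewrite sqr_sqrtr// sumr_ge0// => i _; exact: sqr_ge0. Qed.

Lemma enorm_ge0 (R : realType) (n : nat) (x : 'rV[R]_n) : 0 <= enorm x.
Proof. exact: sqrtr_ge0. Qed.

Lemma le_coord_enorm (R : realType) (n : nat) (x : 'rV[R]_n) (i : 'I_n) :
  `|x ord0 i| <= enorm x.
Proof.
rewrite -sqrtr_sqr ler_wsqrtr// (bigD1 i)//= lerDl sumr_ge0// => j _.
exact: sqr_ge0.
Qed.

Lemma enorm_lt (R : realType) (n : nat) (x : 'rV[R]_n) (a b : R) :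
  (forall i, `|x ord0 i| <= a) -> 0 < b -> n%:R * a ^+ 2 < b ^+ 2 -> enorm x < b.
Proof.
move=> xa b0 ab; rewrite -(@ltr_pXn2r _ 2)// ?nnegrE ?enorm_ge0 ?ltW//.
rewrite enorm_sqr (le_lt_trans _ ab)// mulr_natl.
rewrite -[X in _ *+ X]card_ord -sumr_const ler_sum// => i _.
by rewrite -real_normK ?num_real// lerXn2r ?nnegrE// (le_trans _ (xa i)).
Qed.

Lemma measurable_enormB (R : realType) (n : nat) :
  measurable_fun setT (fun p : 'rV[R]_n * 'rV[R]_n => enorm (p.1 - p.2) ^+ 2).
Proof.
rewrite (_ : (fun p => _) = (fun p =>
    \sum_(i < n) (rV_coord i p.1 - rV_coord i p.2) ^+ 2)); last first.
  apply/funext => p; rewrite enorm_sqr; apply: eq_bigr => i _.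
  by rewrite /rV_coord !mxE.
apply: measurable_sum => i; apply: measurable_funX; apply: measurable_funB.
  exact: (measurableT_comp (measurable_rV_coord i) measurable_fst).
exact: (measurableT_comp (measurable_rV_coord i) measurable_snd).
Qed.

Definition gauss_ker (R : realType) (n : nat) (t : R) (x y : 'rV[R]_n) : R :=
  expR (- (enorm (x - y) ^+ 2 / (4 * t))).

Lemma measurable_gauss_ker (R : realType) (n : nat) (t : R) :
  measurable_fun setT (fun p : 'rV[R]_n * 'rV[R]_n => gauss_ker t p.1 p.2).
Proof.
apply: measurableT_comp; first exact: measurable_expR.
apply: measurable_funN; apply: measurable_funM; last exact: measurable_cst.
exact: measurable_enormB.
Qed.

Lemma measurable_gauss_kerr (R : realType) (n : nat) (t : R) (x : 'rV[R]_n) :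
  measurable_fun setT (gauss_ker t x).
Proof.
exact: (measurableT_comp (@measurable_gauss_ker R n t) (pair1_measurable _)).
Qed.

(** This is the normal density of mean [a] and variance [2 * t], up to the
    normalising factor. *)
Lemma integral_gauss1 (R : realType) (t a : R) : 0 < t ->
  (\int[lebesgue_measure]_x (expR (- ((a - x) ^+ 2 / (4 * t))))%:E =
   (Num.sqrt (4 * pi * t))%:E)%E.
Proof.
move=> t0; pose s := Num.sqrt (2 * t).
have t20 : 0 <= 2 * t by rewrite mulr_ge0// ltW.
have s0 : s != 0 by rewrite gt_eqF// sqrtr_gt0 mulr_gt0.
have := integral_normal_pdf a s; rewrite normal_pdfE//.
have -> : (fun x => (normal_peak s * normal_fun a s x)%:E) =
   (fun x => (normal_peak s)%:E * (expR (- ((a - x) ^+ 2 / (4 * t))))%:E)%E.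
  apply/funext => x; rewrite EFinM; congr (_ * _%:E)%E.
  rewrite /normal_fun; congr expR; rewrite mulNr; congr (- (_ / _)).
    by rewrite -sqrrN opprB.
  by rewrite sqr_sqrtr//; ring.
rewrite ge0_integralZl_EFin ?normal_peak_ge0//; first last.
- apply/measurable_EFinP; apply: measurableT_comp; first exact: measurable_expR.
  apply: measurable_funN; apply: measurable_funM; last exact: measurable_cst.
  by apply: measurable_funX; apply: measurable_funB => //; exact: measurable_cst.
have -> : normal_peak s = (Num.sqrt (4 * pi * t))^-1.
  rewrite /normal_peak; congr (Num.sqrt _)^-1.
  by rewrite sqr_sqrtr//; ring.
have c0 : 0 < Num.sqrt (4 * pi * t) by rewrite sqrtr_gt0 !mulr_gt0// pi_gt0.
move/(congr1 (fun z => (Num.sqrt (4 * pi * t))%:E * z)%E).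
by rewrite muleA -EFinM divff ?gt_eqF// mul1e mule1.
Qed.

Lemma integral_gauss_ker (R : realType) (n : nat) (t : R) (x : 'rV[R]_n) :
  0 < t ->
  (\int[lebesgue_rV R n]_y (gauss_ker t x y)%:E =
   ((4 * pi * t) `^ (n%:R / 2))%:E)%E.
Proof.
move=> t0; have c0 : 0 < 4 * pi * t by rewrite !mulr_gt0// pi_gt0.
elim: n x => [|n IH] x.
  rewrite mul0r powRr0 /= integral_dirac//.
    by rewrite diracE in_setT mul1e /gauss_ker enorm_sqr big_ord0 mul0r oppr0 expR0.
  by apply/measurable_EFinP; exact: measurable_gauss_kerr.
rewrite ge0_integral_rV_succ; first last.
- by move=> y; rewrite lee_fin expR_ge0.
- by apply/measurable_EFinP; exact: measurable_gauss_kerr.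
have -> : x = rV_cons (rV_uncons x) by rewrite rV_unconsK.
case: (rV_uncons x) => x0 x'.
have kE y v : gauss_ker t (rV_cons (x0, x')) (rV_cons (y, v)) =
    expR (- ((x0 - y) ^+ 2 / (4 * t))) * gauss_ker t x' v.
  rewrite /gauss_ker -expRD; congr expR; rewrite -opprD -mulrDl.
  congr (- (_ / _)); rewrite !enorm_sqr big_ord_recl !mxE unlift_none /=.
  congr (_ + _); apply: eq_bigr => i _.
  by rewrite !mxE liftK.
transitivity (\int[lebesgue_measure]_y ((expR (- ((x0 - y) ^+ 2 / (4 * t))))%:E *
    ((4 * pi * t) `^ (n%:R / 2))%:E))%E.
  apply: eq_integral => y _; rewrite -(IH x') -ge0_integralZl_EFin ?expR_ge0//.
  - by apply: eq_integral => v _; rewrite kE EFinM.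
  - by move=> v _; rewrite lee_fin expR_ge0.
  - by apply/measurable_EFinP; exact: measurable_gauss_kerr.
rewrite ge0_integralZr//.
- rewrite integral_gauss1// -EFinM -powR12_sqrt ?ltW// -powRD; last first.
    by rewrite gt_eqF ?implybT.
  by congr (_ `^ _)%:E; rewrite -natr1; field.
- apply/measurable_EFinP; apply: measurableT_comp; first exact: measurable_expR.
  apply: measurable_funN; apply: measurable_funM; last exact: measurable_cst.
  by apply: measurable_funX; apply: measurable_funB => //; exact: measurable_cst.
- by rewrite lee_fin powR_ge0.
Qed.

Lemma measurable_heat (R : realType) (n : nat) (t : R) (u0 : 'rV[R]_n -> R) :
  (forall x, 0 <= u0 x) -> measurable_fun setT u0 ->
  measurable_fun setT (heat t u0).
Proof.
move=> u00 mu0; apply: measurable_funeM.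
apply: (@measurable_fun_fubini_tonelli_F _ _ _ _ _ (lebesgue_rV R n)
  (fun p : 'rV[R]_n * 'rV[R]_n => (gauss_ker t p.1 p.2 * u0 p.2)%:E)).
  apply/measurable_EFinP; apply: measurable_funM.
    exact: measurable_gauss_ker.
  exact: (measurableT_comp mu0 measurable_snd).
by move=> p; rewrite lee_fin mulr_ge0// expR_ge0.
Qed.

(** At distance at least [d] the kernel is at most [8 * t / d ^ 2] times the
    kernel at time [2 * t], whose total mass is known.  So the mass that the
    kernel puts outside the ball of radius [d], where nothing is known of [u0],
    is [O(t)]. *)
Lemma heat_ge (R : realType) (n : nat) (t d v : R) (u0 : 'rV[R]_n -> R)
    (x : 'rV[R]_n) :
  (forall x, 0 <= u0 x) -> measurable_fun setT u0 -> 0 < t -> 0 < d -> 0 <= v ->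
  (forall y, enorm (x - y) < d -> v <= u0 y) ->
  ((v * (1 - 2 `^ (n%:R / 2) * (8 * t / d ^+ 2)))%:E <= heat t u0 x)%E.
Proof.
move=> u00 mu0 t0 d0 v0 vu0.
have c0 : 0 < 4 * pi * t by rewrite !mulr_gt0// pi_gt0.
set q := 8 * t / d ^+ 2.
have q0 : 0 < q by rewrite divr_gt0 ?exprn_gt0 ?mulr_gt0.
set c := (4 * pi * t) `^ (n%:R / 2).
have cp : 0 < c by rewrite powR_gt0.
have mk s : measurable_fun setT (fun y => (gauss_ker s x y)%:E).
  by apply/measurable_EFinP; exact: measurable_gauss_kerr.
have mku : measurable_fun setT (fun y => (gauss_ker t x y * u0 y)%:E).
  by apply/measurable_EFinP; apply: measurable_funM => //;
    exact: measurable_gauss_kerr.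
have ku0 y : (0 <= (gauss_ker t x y * u0 y)%:E)%E.
  by rewrite lee_fin mulr_ge0// expR_ge0.
have k0 s y : (0 <= (gauss_ker s x y)%:E)%E by rewrite lee_fin expR_ge0.
have vq0 : 0 <= v * q by rewrite mulr_ge0// ltW.
(* One pointwise inequality covers both regions, so a single integration is
   enough. *)
have pt y : v * gauss_ker t x y <=
    gauss_ker t x y * u0 y + v * q * gauss_ker (2 * t) x y.
  have [xyd|xyd] := ltP (enorm (x - y)) d.
    rewrite mulrC ler_wpDr//; first by rewrite mulr_ge0// expR_ge0.
    by rewrite ler_wpM2l ?expR_ge0// vu0.
  rewrite ler_wpDl//; first by rewrite mulr_ge0// expR_ge0.
  rewrite -mulrA ler_wpM2l// /gauss_ker.
  set z := enorm (x - y) ^+ 2.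
  have zd : d ^+ 2 <= z by rewrite /z ler_pXn2r// ?nnegrE ?enorm_ge0 ?ltW.
  (* Half of the exponent is spent on the small factor [exp (- a) <= 1 / a]. *)
  have -> : z / (4 * t) = z / (8 * t) + z / (4 * (2 * t)).
    by field; rewrite gt_eqF.
  rewrite opprD expRD ler_wpM2r ?expR_ge0// expRN.
  rewrite -[q]invrK lef_pV2 ?posrE ?expR_gt0 ?invr_gt0//.
  rewrite (@le_trans _ _ (z / (8 * t)))//.
    by rewrite /q invf_div ler_pM2r// invr_gt0 mulr_gt0.
  by apply: le_trans (expR_ge1Dx _); rewrite lerDr.
have : (\int[lebesgue_rV R n]_y (v%:E * (gauss_ker t x y)%:E) <=
   \int[lebesgue_rV R n]_y ((gauss_ker t x y * u0 y)%:E +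
      (v * q)%:E * (gauss_ker (2 * t) x y)%:E))%E.
  apply: ge0_le_integral => //.
  - by move=> y _; rewrite mule_ge0.
  - exact: measurable_funeM.
  - by apply: emeasurable_funD => //; exact: measurable_funeM.
  - by move=> y _; rewrite -!EFinM -EFinD lee_fin.
rewrite ge0_integralD//; first last.
- exact: measurable_funeM.
- by move=> y _; rewrite mule_ge0.
rewrite !ge0_integralZl_EFin// !integral_gauss_ker// ?mulr_gt0// -/c => H.
have c'E : (4 * pi * (2 * t)) `^ (n%:R / 2) = 2 `^ (n%:R / 2) * c.
  rewrite -powRM ?ltW//.
  by congr (_ `^ _); ring.
have cc : (4 * pi * t) `^ (- (n%:R / 2)) = c^-1 by rewrite powRN.
set J := (\int[lebesgue_rV R n]_y (gauss_ker t x y * u0 y)%:E)%E in H.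
have -> : heat t u0 x = ((c^-1)%:E * J)%E by rewrite /heat cc.
move: H; rewrite c'E.
have J0 : (0 <= J)%E by exact: integral_ge0.
move: J J0 => [J| |] // _.
  rewrite -!EFinM -EFinD !lee_fin => H.
  rewrite -(ler_pM2l cp) mulrA divff ?gt_eqF// mul1r.
  rewrite -lerBlDr in H; apply: le_trans H; rewrite le_eqVlt; apply/orP; left.
  by apply/eqP; ring.
by move=> _; rewrite gt0_muley ?leey// lte_fin invr_gt0.
Qed.

(** * The tail integral of [1 / f] *)

Section tail.
Context {R : realType}.
Variable f : R -> R.
Hypothesis f_C1 : C1_halfline f.
Hypothesis f_gt0 : forall s, 0 < s -> 0 < f s.
Hypothesis df_gt0 : forall s, 0 < s -> 0 < derive1 f s.
Hypothesis F_fin : forall s, 0 < s -> (F_tail f s < +oo)%E.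

Lemma C1_halfline_derivable (s : R) : 0 < s -> derivable f s 1.
Proof.
move=> s0; have [df [H _]] := f_C1.
have {}H := H s (ltW s0).
apply: (cvgP (df s)).
apply/cvgrPdist_lt => e e0.
have /cvgrPdist_lt/(_ e e0) := H.
rewrite /prop_near1 /= !nbhs_nearE => /nbhs_ballP[d /= d0 dH].
apply/nbhs_ballP; exists (Num.min d s) => /=; first by rewrite lt_min d0.
move=> h; rewrite /ball/= sub0r normrN lt_min => /andP[hd hs] h0.
have := dH (h + s); rewrite /ball/= opprD addrCA subrr addr0 normrN => /(_ hd).
have hs0 : h + s != s by rewrite -subr_eq0 addrK.
have hsge : 0 <= h + s.
  by rewrite -lerBlDr sub0r; move: hs; rewrite ltr_norml => /andP[/ltW].
by move=> /(_ hs0 hsge); rewrite addrK mulrC /= scaler1.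
Qed.

(** At [0] this holds because the one-sided derivative forces right
    continuity there. *)
Lemma C1_halfline_ge0 (s : R) : 0 <= s -> 0 <= f s.
Proof.
rewrite le_eqVlt => /predU1P[<-|/f_gt0/ltW//].
have [df [/(_ 0 (lexx _)) H _]] := f_C1.
rewrite leNgt; apply/negP => f0.
have /cvgrPdist_lt/(_ 1 ltr01) := H.
rewrite /prop_near1 /= !nbhs_nearE => /nbhs_ballP[d /= d0 dH].
set M := `|df 0| + 1; have M0 : 0 < M by rewrite ltr_wpDl.
pose y := Num.min (d / 2) (- f 0 / (2 * M)).
have y0 : 0 < y by rewrite lt_min !divr_gt0 ?oppr_gt0 ?mulr_gt0.
have yd : y < d.
  by rewrite gt_min ltr_pdivrMr// ltr_pMr// ltr1n.
have := dH y; rewrite /ball/= sub0r normrN gtr0_norm// subr0.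
move=> /(_ yd); rewrite gt_eqF// => /(_ isT (ltW y0)).
rewrite distrC => /ltr_distlDr H1.
have {}H1 : (f y - f 0) / y < M.
  by apply: lt_le_trans H1 _; have := ler_norm (df 0); rewrite /M; lra.
move: H1; rewrite ltr_pdivrMr// => H1.
have : y * (2 * M) <= - f 0.
  by rewrite -ler_pdivlMr ?mulr_gt0// ge_min lexx orbT.
have := f_gt0 y0; nra.
Qed.

Lemma C1_is_derive (s : R) : 0 < s -> is_derive s 1 f (derive1 f s).
Proof.
move=> s0; apply: DeriveDef; first exact: C1_halfline_derivable.
by rewrite derive1E.
Qed.

Lemma C1_continuous (s : R) : 0 < s -> {for s, continuous f}.
Proof.
move=> s0; apply: differentiable_continuous; apply/derivable1_diffP.
exact: C1_halfline_derivable.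
Qed.

Lemma gt0_within_continuous (a b : R) (g : R -> R) : 0 < a ->
  (forall s, 0 < s -> {for s, continuous g}) -> {within `[a, b], continuous g}.
Proof.
move=> a0 cg; apply: continuous_in_subspaceT => x.
rewrite inE/= in_itv/= => /andP[ax _]; apply: cg; exact: lt_le_trans ax.
Qed.

Lemma C1_MVT (a b : R) : 0 < a -> a < b ->
  exists2 c, a < c < b & f b - f a = derive1 f c * (b - a).
Proof.
move=> a0 ab; have [||c] := @MVT R f (derive1 f) a b ab.
- move=> x; rewrite in_itv/= => /andP[ax _]; apply: C1_is_derive.
  exact: lt_trans ax.
- by apply: gt0_within_continuous => // s; exact: C1_continuous.
- by rewrite in_itv/=; exists c.
Qed.

Lemma C1_lt (a b : R) : 0 < a -> a < b -> f a < f b.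
Proof.
move=> a0 ab; have [c /andP[ac cb] E] := C1_MVT a0 ab.
rewrite -subr_gt0 E mulr_gt0 ?subr_gt0//; apply: df_gt0; exact: lt_trans ac.
Qed.

(** The real value of [F_tail], which is finite at positive arguments; at [0]
    the integral may diverge, and this value is then [0] by convention. *)
Definition Ftail (s : R) : R := fine (F_tail f s).

Lemma measurable_invf (a : R) : 0 <= a ->
  measurable_fun `]a, +oo[ (fun u => ((f u)^-1)%:E).
Proof.
move=> a0; apply/measurable_EFinP; apply: open_continuous_measurable_fun.
  exact: interval_open.
move=> x; rewrite inE/= in_itv/= andbT => ax.
have x0 : 0 < x by exact: le_lt_trans ax.
by apply: cvgV; [rewrite gt_eqF ?f_gt0|exact: C1_continuous].
Qed.

Lemma F_tail_ge0 (s : R) : 0 <= s -> (0 <= F_tail f s)%E.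
Proof.
move=> s0; apply: integral_ge0 => u /=; rewrite in_itv/= andbT => su.
by rewrite lee_fin invr_ge0 ltW// f_gt0// (le_lt_trans s0).
Qed.

Lemma F_tailE (s : R) : 0 < s -> F_tail f s = (Ftail s)%:E.
Proof. by move=> s0; rewrite fineK// ge0_fin_numE ?F_fin// F_tail_ge0// ltW. Qed.

Lemma F_tail_split (a b : R) : 0 < a -> a < b ->
  (F_tail f a = \int[lebesgue_measure]_(u in `]a, b]) ((f u)^-1)%:E
     + F_tail f b)%E.
Proof.
move=> a0 ab; rewrite /F_tail.
have abE : `]a, +oo[%classic = `]a, b]%classic `|` `]b, +oo[%classic.
  by rewrite -itv_bndbnd_setU// bnd_simp ltW.
have mf := measurable_invf (ltW a0).
rewrite abE in mf *; apply: ge0_integral_setU => //.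
- move=> u; rewrite -abE/= in_itv/= andbT => au.
  by rewrite lee_fin invr_ge0 ltW// f_gt0// (lt_trans a0).
- apply/disj_setPS => u [] /=; rewrite !in_itv/= andbT => /andP[_ ub].
  by rewrite ltNge ub.
Qed.

(** [f] is increasing, so [1 / f] lies between its values at the end points.
    The derivative of the tail integral is obtained from this estimate. *)
Lemma Ftail_diff (a b : R) : 0 < a -> a < b ->
  (b - a) / f b <= Ftail a - Ftail b <= (b - a) / f a.
Proof.
move=> a0 ab; have b0 : 0 < b by exact: lt_trans ab.
have := F_tail_split a0 ab; rewrite !F_tailE// => H.
have mf : measurable_fun `]a, b] (fun u => ((f u)^-1)%:E).
  apply: measurable_funS (measurable_invf (ltW a0)) => //.
  by move=> u /=; rewrite !in_itv/= andbT => /andP[].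
have {}H : (\int[lebesgue_measure]_(u in `]a, b]) ((f u)^-1)%:E
    = (Ftail a - Ftail b)%:E)%E.
  by rewrite EFinB H addeK.
apply/andP; split; rewrite -lee_fin -H.
- rewrite (_ : ((b - a) / f b)%:E =
    \int[lebesgue_measure]_(u in `]a, b]) ((f b)^-1)%:E)%E; last first.
    by rewrite integral_cst//= lebesgue_measure_itv/= lte_fin ab -EFinD -EFinM mulrC.
  apply: ge0_le_integral => //.
  - by move=> u _; rewrite lee_fin invr_ge0 ltW// f_gt0.
  - move=> u /=; rewrite in_itv/= => /andP[au]; rewrite le_eqVlt => /predU1P[->//|ub].
    have u0 : 0 < u by exact: lt_trans au.
    by rewrite lee_fin lef_pV2 ?posrE ?f_gt0// ltW// C1_lt.
- rewrite (_ : ((b - a) / f a)%:E =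
    \int[lebesgue_measure]_(u in `]a, b]) ((f a)^-1)%:E)%E; last first.
    by rewrite integral_cst//= lebesgue_measure_itv/= lte_fin ab -EFinD -EFinM mulrC.
  apply: ge0_le_integral => //.
  - move=> u /=; rewrite in_itv/= => /andP[au _].
    by rewrite lee_fin invr_ge0 ltW// f_gt0// (lt_trans a0).
  - move=> u /=; rewrite in_itv/= => /andP[au _].
    have u0 : 0 < u by exact: lt_trans au.
    by rewrite lee_fin lef_pV2 ?posrE ?f_gt0// ltW// C1_lt.
Qed.

Lemma Ftail_lt (a b : R) : 0 < a -> a < b -> Ftail b < Ftail a.
Proof.
move=> a0 ab; have /andP[+ _] := Ftail_diff a0 ab.
rewrite -subr_gt0; apply: lt_le_trans.
by rewrite divr_gt0 ?subr_gt0// f_gt0// (lt_trans a0).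
Qed.

Lemma Ftail_le (a b : R) : 0 < a -> a <= b -> Ftail b <= Ftail a.
Proof.
by move=> a0; rewrite le_eqVlt => /predU1P[->//|/(Ftail_lt a0)/ltW].
Qed.

Lemma Ftail_gt0 (s : R) : 0 < s -> 0 < Ftail s.
Proof.
move=> s0; have s1 : s < s + 1 by rewrite ltrDl.
apply: le_lt_trans (Ftail_lt s0 s1).
by apply: fine_ge0; apply: F_tail_ge0; rewrite addr_ge0// ltW.
Qed.

End tail.

Section tail_calculus.
Context {R : realType}.
Variable f : R -> R.
Hypothesis f_C1 : C1_halfline f.
Hypothesis f_gt0 : forall s, 0 < s -> 0 < f s.
Hypothesis df_gt0 : forall s, 0 < s -> 0 < derive1 f s.
Hypothesis F_fin : forall s, 0 < s -> (F_tail f s < +oo)%E.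
Notation Ftail := (Ftail f).

Lemma Ftail_is_derive (s : R) : 0 < s -> is_derive s 1 Ftail (- (f s)^-1).
Proof.
move=> s0.
suff H : h^-1 *: (Ftail (h *: 1 + s) - Ftail s) @[h --> 0^'] --> - (f s)^-1.
  by apply: DeriveDef; [exact: cvgP H|exact/cvg_lim].
have cf : (f (h + s))^-1 @[h --> 0] --> (f s)^-1.
  apply: cvgV; first by rewrite gt_eqF ?f_gt0.
  apply: (@cvg_comp _ _ _ (fun h => h + s) f _ (nbhs s)).
    have : (h + s) @[h --> (0 : R)] --> 0 + s.
      by apply: cvgD; [exact: cvg_id|exact: cvg_cst].
    by rewrite add0r.
  exact: (C1_continuous f_C1).
apply/cvgrPdist_lt => e e0.
have /cvgrPdist_lt/(_ e e0) := cf.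
move=> /nbhs_ballP[d /= d0 dH].
apply/nbhs_ballP; exists (Num.min d s) => /=; first by rewrite lt_min d0.
move=> h; rewrite /ball/= sub0r normrN lt_min => /andP[hd hs] h0.
have := dH h; rewrite /ball/= sub0r normrN => /(_ hd).
apply: le_lt_trans; rewrite /= scaler1 -normrN opprD opprK.
have hs0 : 0 < h + s by move: hs; rewrite ltr_norml; lra.
have [hlt|hgt|h00] := ltgtP h 0; last by rewrite h00 eqxx in h0.
- have hss : h + s < s by lra.
  have := Ftail_diff f_C1 f_gt0 df_gt0 F_fin hs0 hss.
  set a := Ftail _ - _; rewrite opprD addrCA subrr addr0 !mulNr => /andP[H1 H2].
  have h'0 : 0 < - h by lra.
  have {}H1 : (f s)^-1 <= - (h^-1 * a).
    rewrite -mulNr -invrN mulrC ler_pdivlMr// mulrC; lra.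
  have {}H2 : - (h^-1 * a) <= (f (h + s))^-1.
    rewrite -mulNr -invrN mulrC ler_pdivrMr// mulrC; lra.
  rewrite /GRing.scale/= distrC ger0_norm; last by lra.
  rewrite ler0_norm; lra.
- have hss : s < h + s by lra.
  have := Ftail_diff f_C1 f_gt0 df_gt0 F_fin s0 hss.
  rewrite addrK; set a := Ftail (h + s); set b := Ftail s => /andP[H1 H2].
  have {}H1 : (f (h + s))^-1 <= - (h^-1 * (a - b)).
    by rewrite -mulrN opprB mulrC ler_pdivlMr// mulrC.
  have {}H2 : - (h^-1 * (a - b)) <= (f s)^-1.
    by rewrite -mulrN opprB mulrC ler_pdivrMr// mulrC.
  rewrite /GRing.scale/= ger0_norm; last by lra.
  rewrite ger0_norm; lra.
Qed.

Lemma Ftail_cvg0 (e : R) : 0 < e -> exists2 S : R, 0 < S & forall s, S <= s -> Ftail s < e.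
Proof.
move=> e0.
pose F (i : nat) := `]1%R, i%:R + 2]%classic : set (measurableTypeR R).
have FU : \bigcup_i F i = `]1%R, +oo[%classic.
  apply/seteqP; split => [x [i _]|x] /=; rewrite /F/= !in_itv/=; first by case/andP => ->.
  rewrite andbT => x1; exists (Num.truncn x) => //=; rewrite in_itv/= x1/=.
  by have := truncnS_gt x; rewrite -natr1; lra.
have := @ge0_nondecreasing_set_cvg_integral _ _ R F (fun u => ((f u)^-1)%:E)
  lebesgue_measure.
rewrite FU -/(F_tail f 1) F_tailE// => H.
have {}H : (\int[lebesgue_measure]_(x in F i) ((f x)^-1)%:E)%E @[i --> \oo]
    --> (Ftail 1)%:E.
  apply: H.
  - apply/nondecreasing_seqP => i; rewrite subsetEset => x.
    rewrite /F/= !in_itv/= => /andP[-> xi]/=; rewrite (le_trans xi)// lerD2r.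
    by rewrite ler_nat.
  - by move=> i; exact: measurable_itv.
  - move=> i; apply: measurable_funS (measurable_invf f_C1 f_gt0 ler01) => //.
    by move=> x; rewrite /F/= !in_itv/= => /andP[->].
  - move=> i x; rewrite /F/= in_itv/= => /andP[x1 _].
    by rewrite lee_fin invr_ge0 ltW// f_gt0// (lt_trans _ x1).
have E i : (\int[lebesgue_measure]_(x in F i) ((f x)^-1)%:E =
    (Ftail 1 - Ftail (i%:R + 2))%:E)%E.
  have i1 : 1 < i%:R + 2 :> R by rewrite ltr_wpDl// ltr1n.
  have i0 : 0 < i%:R + 2 :> R by rewrite ltr_wpDl.
  have := F_tail_split f_C1 f_gt0 ltr01 i1.
  by rewrite !F_tailE// EFinB => ->; rewrite addeK.
move: H; under eq_fun do rewrite E.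
move=> /fine_cvgP[_ /cvgrPdist_lt/(_ e e0)].
move=> -[i _ /(_ i (leqnn _))] /=.
rewrite opprB addrCA subrr addr0 => iH.
exists (i%:R + 2) => [|s iS]; first by rewrite ltr_wpDl.
apply: le_lt_trans iH; rewrite (le_trans _ (ler_norm _))//.
by apply: (Ftail_le f_C1) => //; rewrite ltr_wpDl.
Qed.

Variable A : R.
Hypothesis A_ge1 : 1 <= A.
Hypothesis A_lim : ((derive1 f s)%:E * F_tail f s)%E @[s --> +oo] --> A%:E.
Hypothesis A_below : exists2 s2 : R, 0 < s2 &
     forall s, s2 <= s -> (A%:E <= (derive1 f s)%:E * F_tail f s)%E.

Let A_gt0 : 0 < A. Proof. exact: lt_le_trans A_ge1. Qed.

(** The lower bound is the hypothesis [f' * F >= A]; the upper one is the limit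
    [A], since [A < 2 * A]. *)
Lemma dfF_bounds : exists2 S : R, 0 < S &
  forall s, S <= s -> A / Ftail s <= derive1 f s <= 2 * A / Ftail s.
Proof.
have [s2 s20 Hs2] := A_below.
have nb : nbhs A%:E [set z | (z < (2 * A)%:E)%E].
  apply: open_nbhs_nbhs; split; first exact: open_ereal_lt_ereal.
  by rewrite /= lte_fin ltr_pMl ?ltr1n // (lt_le_trans ltr01).
have [M [_ HM]] := A_lim nb.
exists (Num.max s2 (M + 1)); first by rewrite lt_max s20.
move=> s; rewrite ge_max => /andP[ss2 sM].
have s0 : 0 < s by exact: lt_le_trans ss2.
have Ms : M < s by apply: lt_le_trans sM; rewrite ltrDl.
have := Hs2 s ss2; have /= := HM s Ms.
rewrite F_tailE// -EFinM lte_fin lee_fin => H1 H2.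
have F0 := Ftail_gt0 f_C1 f_gt0 df_gt0 F_fin s0.
by rewrite ler_pdivrMr// ler_pdivlMr// H2/= ltW.
Qed.

Lemma f_unbounded (K : R) : exists2 S : R, 0 < S & forall y, S <= y -> K <= f y.
Proof.
have [S S0 HS] := dfF_bounds.
have FS := Ftail_gt0 f_C1 f_gt0 df_gt0 F_fin S0.
set m := A / Ftail S; have m0 : 0 < m by exact: divr_gt0.
have Km : 0 <= `|K| / m by rewrite divr_ge0// ltW.
exists (S + 1 + `|K| / m).
  lra.
move=> y yS.
have Sy : S < y.
  lra.
have [c /andP[Sc cy] E] := C1_MVT f_C1 S0 Sy.
have /andP[H _] := HS c (ltW Sc).
have {}H : m <= derive1 f c.
  apply: le_trans H; rewrite /m ler_pM2l//.
  have c0 := lt_trans S0 Sc.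
  by rewrite lef_pV2 ?posrE// ?(Ftail_gt0 f_C1)// ltW// (Ftail_lt f_C1).
have fS0 := f_gt0 S0.
have : `|K| <= m * (y - S).
  rewrite mulrC -ler_pdivrMr//; lra.
have := ler_norm K; have : m * (y - S) <= derive1 f c * (y - S).
  by rewrite ler_wpM2r// subr_ge0 ltW.
lra.
Qed.

(** Substitute for convexity: a line of slope [A / F y] lies below [f], and the
    price is the factor [1 / 4] at [y].  To the right of [y] the slope of [f]
    is at least [A / F y]; to the left it is at most twice that, and averaging the
    resulting bound with [f >= 0] gives the claim; far to the left the line is
    negative. *)
Lemma supporting_line : exists2 S : R, 0 < S & forall y s, S <= y -> 0 <= s ->
  f y / 4 + A / Ftail y * (s - y) <= f s.
Proof.
have [S3 S30 HS3] := dfF_bounds.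
have [S4 S40 HS4] := f_unbounded (2 * f S3).
exists (Num.max S3 S4) => [|y s]; first by rewrite lt_max S30.
rewrite ge_max => /andP[yS3 yS4] s0.
have y0 : 0 < y by exact: lt_le_trans yS3.
have fs0 := C1_halfline_ge0 f_C1 f_gt0 s0.
have fy0 := f_gt0 y0; have fS30 := f_gt0 S30.
have {}HS4 := HS4 _ yS4.
have Fy0 := Ftail_gt0 f_C1 f_gt0 df_gt0 F_fin y0.
set m := A / Ftail y; have m0 : 0 < m by exact: divr_gt0.
have up s' : S3 <= s' -> s' < y -> f y - f s' <= 2 * (m * (y - s')).
  move=> Ss sy; have s'0 : 0 < s' by exact: lt_le_trans Ss.
  have [c /andP[sc cy] ->] := C1_MVT f_C1 s'0 sy.
  have /andP[_ H] := HS3 c (le_trans Ss (ltW sc)).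
  rewrite mulrA ler_wpM2r//; first by rewrite subr_ge0 ltW.
  apply: (le_trans H); rewrite /m mulrA ler_wpM2l//; first by rewrite mulr_ge0// ltW.
  have c0 := lt_trans s'0 sc.
  by rewrite lef_pV2 ?posrE// ?(Ftail_gt0 f_C1)// ltW// (Ftail_lt f_C1).
have [ys|sy|->] := ltgtP y s; last by rewrite subrr; lra.
- have [c /andP[yc cs] E] := C1_MVT f_C1 y0 ys.
  have /andP[H _] := HS3 c (le_trans yS3 (ltW yc)).
  have : m * (s - y) <= derive1 f c * (s - y).
    rewrite ler_wpM2r//; first by rewrite subr_ge0 ltW.
    apply: le_trans H; rewrite /m ler_wpM2l//; first exact: ltW.
    have c0 := lt_trans y0 yc.
    by rewrite lef_pV2 ?posrE// ?(Ftail_gt0 f_C1)// ltW// (Ftail_lt f_C1).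
  by lra.
- have [S3s|sS3] := leP S3 s; first by have := up _ S3s sy; nra.
  have H : f y - f S3 <= 2 * (m * (y - S3)).
    move: yS3; rewrite le_eqVlt => /predU1P[<-|]; first by rewrite !subrr; lra.
    exact: up.
  nra.
Qed.

(** The derivative of [f * F ^ th] is [F ^ (th - 1) * (f' * F - th)], which is
    at least [(1 - th) * F ^ (th - 1)] and tends to infinity with [1 / F]. *)
Lemma fF_superlinear (th K : R) : 0 < th < 1 -> 0 <= K ->
  exists2 S : R, 0 < S & forall y, S <= y -> K * y <= f y * Ftail y `^ th.
Proof.
move=> /andP[th0 th1] K0.
have [S3 S30 HS3] := dfF_bounds.
(* Below [e] the tail satisfies [(1 - th) * F ^ (th - 1) >= 2 * K + 1]; the
   factor [2] pays for replacing [y - S] by [y / 2] at the end. *)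
pose e := ((2 * K + 1) / (1 - th)) `^ ((th - 1)^-1).
have q0 : 0 < (2 * K + 1) / (1 - th) by rewrite divr_gt0//; lra.
have e0 : 0 < e by rewrite powR_gt0.
have [S4 S40 HS4] := Ftail_cvg0 e0.
pose S := Num.max S3 S4.
have S0 : 0 < S by rewrite lt_max S30.
have F0 y : 0 < y -> 0 < Ftail y by exact: (Ftail_gt0 f_C1).
exists (2 * S) => [|y yS]; first by rewrite mulr_gt0.
pose g := fun y => f y * Ftail y `^ th.
pose dg := fun y => Ftail y `^ (th - 1) * (derive1 f y * Ftail y - th).
have gd (x : R) : 0 < x -> is_derive x 1 g (dg x).
  move=> x0; have Fx0 := F0 x x0; have fx0 := f_gt0 x0.
  have d1 := C1_is_derive f_C1 x0.
  have d2 := Ftail_is_derive x0.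
  have d3 := @is_derive1_powR _ th _ Fx0.
  have d4 : is_derive x 1 (fun y => Ftail y `^ th)
      (th * Ftail x `^ (th - 1) * - (f x)^-1).
    exact: (is_derive1_comp d3 d2).
  have := @is_deriveM _ _ f (fun y => Ftail y `^ th) x 1 _ _ d1 d4.
  move=> H; apply: is_derive_eq H _.
  rewrite /dg /GRing.scale/= -(@mulr_powRB1 _ (Ftail x) th)// ?ltW//.
  by field; exact: lt0r_neq0.
have Sy : S < y by lra.
have [||c] := @MVT R g dg S y Sy.
- by move=> x; rewrite in_itv/= => /andP[Sx _]; apply: gd; exact: lt_trans Sx.
- apply: gt0_within_continuous => // x x0; apply: differentiable_continuous.
  by apply/derivable1_diffP; have [] := gd x x0.
rewrite in_itv/= => /andP[Sc cy] E.
have c0 : 0 < c by exact: lt_trans Sc.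
have cS3 : S3 <= c by apply: le_trans (ltW Sc); rewrite le_max lexx.
have cS4 : S4 <= c by apply: le_trans (ltW Sc); rewrite le_max lexx orbT.
have /andP[H _] := HS3 c cS3.
have Fc0 := F0 c c0.
have {}H : 1 - th <= derive1 f c * Ftail c - th.
  by rewrite lerD2r (le_trans A_ge1)// -ler_pdivrMr.
have H2 : (2 * K + 1) / (1 - th) <= Ftail c `^ (th - 1).
  have := HS4 c cS4 => /ltW Fe.
  have qe : e `^ (th - 1) = (2 * K + 1) / (1 - th).
    by rewrite /e -powRrM mulVf ?powRr1 ?(ltW q0)// lt_eqF// subr_lt0.
  rewrite -qe -(opprB 1 th) !powRN lef_pV2 ?posrE ?powR_gt0//.
  by apply: ge0_ler_powR => //; rewrite ?nnegrE ?subr_ge0; exact: ltW.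
have th'0 : 0 < 1 - th by rewrite subr_gt0.
have E3 : (2 * K + 1) / (1 - th) * (1 - th) = 2 * K + 1.
  by rewrite divfK// gt_eqF.
have H3 : 2 * K + 1 <= dg c.
  by rewrite -E3 /dg; apply: ler_pM => //; exact: ltW.
have gS : 0 < g S by rewrite mulr_gt0 ?f_gt0 ?powR_gt0 ?F0.
have g0 : g y = g S + dg c * (y - S) by rewrite -E addrC subrK.
have H4 : (2 * K + 1) * (y - S) <= dg c * (y - S).
  by rewrite ler_wpM2r// subr_ge0 ltW.
suff H5 : K * y <= (2 * K + 1) * (y - S).
  by rewrite -/(g y) g0 ler_wpDl ?(ltW gS)// (le_trans H5).
have y2S : 0 <= K * (y - 2 * S) by rewrite mulr_ge0// subr_ge0.
rewrite -subr_ge0.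
have -> : (2 * K + 1) * (y - S) - K * y = K * (y - 2 * S) + (y - S) by ring.
by rewrite addr_ge0// subr_ge0 ltW.
Qed.

End tail_calculus.

(** * The cosine weight on a cube *)

(** The first Dirichlet eigenfunction of the interval of half-length [pi / 2],
    extended by zero. *)
Definition cosbump (R : realType) (s : R) : R :=
  if `|s| < pi / 2 then cos s else 0.

Lemma cosbump_ge0 (R : realType) (s : R) : 0 <= cosbump s.
Proof.
rewrite /cosbump; case: ifPn => // s2.
by apply: cos_ge0_pihalf; rewrite -ler_norml ltW.
Qed.

Lemma cosbump_le1 (R : realType) (s : R) : cosbump s <= 1.
Proof. by rewrite /cosbump; case: ifP => // _; exact: cos_le1. Qed.

Lemma cosbump_ge_cos1 (R : realType) (s : R) : `|s| < 1 -> cos 1 <= cosbump s.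
Proof.
move=> s1; have pi1 := @pihalf_ge1 R.
rewrite /cosbump (lt_le_trans s1 pi1) -(cos_norm s).
have [->|s0] := eqVneq `|s| 1; first by rewrite lexx.
rewrite ltW// ltr_cos ?in_itv/=// ?normr_ge0 ?ler01/=.
  by rewrite (le_trans (ltW s1))//; have := @pi_ge2 R; lra.
by have := @pi_ge2 R; lra.
Qed.

Lemma measurable_cosbump (R : realType) :
  measurable_fun [set: measurableTypeR R] (@cosbump R).
Proof.
apply: measurable_fun_ifT => //.
- apply: measurable_fun_ltr; last exact: measurable_cst.
  exact: normr_measurable.
- exact: continuous_measurable_fun (@continuous_cos R).
Qed.

(** The cosine is nonpositive between [pi / 2] and [3 * pi / 2], so the
    truncation stays above it slightly beyond the end points as well. *)
Lemma le_cosbump (R : realType) (s : R) :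
  `|s| <= pi / 2 + 2 -> cos s <= cosbump s.
Proof.
move=> s2; rewrite /cosbump; case: ifPn => //; rewrite -leNgt => s1.
rewrite -(cos_norm s) -[`|s|](subrK pi) cosDpi oppr_le0.
apply: cos_ge0_pihalf; have := @pi_ge2 R; lra.
Qed.

Lemma cos_ge_quadratic (R : realType) (h : R) : 0 < h -> h < 2 ->
  1 - h ^+ 2 / 2 <= cos h.
Proof.
move=> h0 h2; set y := h / 2.
have y0 : 0 < y by rewrite /y; lra.
have sy0 : 0 <= sin y.
  by apply: sin_ge0_pi; have := @pi_ge2 R; rewrite /y; lra.
have syy : sin y <= y.
  have [|c _] := @MVT R sin cos 0 y y0 (fun x _ => is_derive_sin x).
    by apply: continuous_subspaceT => x; exact: continuous_sin.
  rewrite sin0 !subr0 => ->; rewrite ler_piMl ?cos_le1//; exact: ltW.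
have -> : h = y *+ 2 by rewrite /y -mulr_natr divfK.
rewrite cos_mulr2n cos2sin2.
have -> : (y *+ 2) ^+ 2 / 2 = 2 * y ^+ 2 by field.
have : sin y ^+ 2 <= y ^+ 2 by rewrite ler_pXn2r ?nnegrE ?(ltW y0).
rewrite -[X in _ -> _ <= X - _]mulr_natr; lra.
Qed.

(** Weak form of [w'' >= - w].  On the support, [w] equals the cosine at [s] and
    dominates it at [s + h] and [s - h], so that its second difference is at
    least that of the cosine, which is explicit; off the support the right-hand
    side is nonnegative.  The kinks of [w] at the end points are convex, which
    is why no error term appears. *)
Lemma cosbump_second_diff (R : realType) (s h : R) : 0 < h -> h < 2 ->
  2 * cosbump s <= cosbump (s + h) + cosbump (s - h) + h ^+ 2 * cosbump s.
Proof.
move=> h0 h2; have [s1|s1] := ltP `|s| (pi / 2); last first.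
  rewrite {1 4}/cosbump ltNge s1/= !mulr0 addr0.
  by rewrite addr_ge0// cosbump_ge0.
have H1 : cos (s + h) <= cosbump (s + h).
  by apply: le_cosbump; rewrite (le_trans (ler_normD _ _))// (gtr0_norm h0); lra.
have H2 : cos (s - h) <= cosbump (s - h).
  by apply: le_cosbump; rewrite (le_trans (ler_normB _ _))// (gtr0_norm h0); lra.
have -> : cosbump s = cos s by rewrite /cosbump s1.
rewrite cosD in H1; rewrite cosB in H2.
have cs0 : 0 <= cos s by apply: cos_ge0_pihalf; rewrite -ler_norml ltW.
have := ler_wpM2l cs0 (cos_ge_quadratic h0 h2); lra.
Qed.

Definition cubebump (R : realType) (n : nat) (p : 'rV[R]_n) (l : R)
  (x : 'rV[R]_n) : R := \prod_(i < n) cosbump ((x ord0 i - p ord0 i) / l).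

Lemma cubebump_ge0 (R : realType) (n : nat) (p : 'rV[R]_n) (l : R) x :
  0 <= cubebump p l x.
Proof. by apply: prodr_ge0 => i _; exact: cosbump_ge0. Qed.

Lemma cubebump_le1 (R : realType) (n : nat) (p : 'rV[R]_n) (l : R) x :
  cubebump p l x <= 1.
Proof. by apply: prodr_ile1 => i _; rewrite cosbump_ge0 cosbump_le1. Qed.

Lemma cubebump_neq0 (R : realType) (n : nat) (p : 'rV[R]_n) (l : R) x i :
  0 < l -> cubebump p l x != 0 -> `|x ord0 i - p ord0 i| < pi / 2 * l.
Proof.
move=> l0; apply: contraR; rewrite -leNgt => H; apply/eqP.
rewrite /cubebump (bigD1 i)//= /cosbump ifF ?mul0r//.
by apply/negbTE; rewrite -leNgt normrM normfV (gtr0_norm l0) ler_pdivlMr.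
Qed.

Lemma cubebump_eq0 (R : realType) (n : nat) (p : 'rV[R]_n) (l : R) x :
  0 < l -> ~ `|x - p| < 2 * l -> cubebump p l x = 0.
Proof.
move=> l0 H; apply/eqP; apply: contra_notT H => H.
rewrite rV_norm_lt ?mulr_gt0//; apply/forallP => i; rewrite !mxE.
by apply: (lt_trans (cubebump_neq0 i l0 H)); rewrite ltr_pM2r// pihalf_lt2.
Qed.

Lemma measurable_cubebump (R : realType) (n : nat) (p : 'rV[R]_n) (l : R) :
  measurable_fun setT (cubebump p l).
Proof.
apply: measurable_prod => i _.
apply: (measurableT_comp (@measurable_cosbump R)).
apply: measurable_funM; last exact: measurable_cst.
apply: measurable_funB; last exact: measurable_cst.
exact: measurable_rV_coord.
Qed.

Lemma cubebump_second_diff (R : realType) (n : nat) (p : 'rV[R]_n) (l h : R)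
    (i : 'I_n) (x : 'rV[R]_n) : 0 < l -> 0 < h -> h < 2 * l ->
  2 * cubebump p l x <= cubebump p l (x + h *: delta_mx ord0 i)
    + cubebump p l (x - h *: delta_mx ord0 i) + (h / l) ^+ 2 * cubebump p l x.
Proof.
move=> l0 h0 hl.
have BD y : cubebump p l y = cosbump ((y ord0 i - p ord0 i) / l) *
    \prod_(j < n | j != i) cosbump ((y ord0 j - p ord0 j) / l).
  by rewrite /cubebump (bigD1 i).
rewrite !BD !mxE !eqxx !mulr1.
have E (k : R) : \prod_(j < n | j != i) cosbump
    (((x + k *: delta_mx ord0 i) ord0 j - p ord0 j) / l) =
  \prod_(j < n | j != i) cosbump ((x ord0 j - p ord0 j) / l).
  apply: eq_bigr => j ji; rewrite !mxE eqxx andTb.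
  by rewrite (negbTE ji) mulr0 addr0.
rewrite -scaleNr !E.
set P := \prod_(j < n | j != i) _.
have P0 : 0 <= P by apply: prodr_ge0 => j _; exact: cosbump_ge0.
set s := (x ord0 i - p ord0 i) / l.
have -> : (x ord0 i + h - p ord0 i) / l = s + h / l by rewrite /s; field; exact: lt0r_neq0.
have -> : (x ord0 i - h - p ord0 i) / l = s - h / l by rewrite /s; field; exact: lt0r_neq0.
have := @cosbump_second_diff R s (h / l) ltac:(by rewrite divr_gt0)
  ltac:(by rewrite ltr_pdivrMr).
move=> /(ler_wpM2r P0); lra.
Qed.

Lemma lebesgue_rV_ball (R : realType) (n : nat) (p : 'rV[R]_n) (e : R) : 0 < e ->
  lebesgue_rV R n [set x | `|x - p| < e] = ((2 * e) ^+ n)%:E.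
Proof.
move=> e0.
rewrite (_ : mkset _ = [set x : 'rV[R]_n | forall i : 'I_n,
   `]p ord0 i - e, p ord0 i + e[%classic (x ord0 i)]).
  rewrite (@lebesgue_rV_box R n (fun i =>
    `]p ord0 i - e, p ord0 i + e[%classic)); last by move=> i; exact: measurable_itv.
  rewrite (eq_bigr (fun=> (2 * e)%:E)).
    by rewrite -(big_morph EFin EFinM erefl) prodr_const card_ord.
  move=> i _; rewrite lebesgue_measure_itv/= lte_fin ltrD2l gtrN// -EFinB.
  by congr _%:E; ring.
apply/seteqP; split => x /=; rewrite rV_norm_lt//.
  by move=> /forallP xe i; have := xe i; rewrite !mxE ltr_distl in_itv.
by move=> xe; apply/forallP => i; have := xe i; rewrite !mxE ltr_distl in_itv.
Qed.

(** * Integrals against the cosine weight *)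

(** Closed, hence compact, and containing the support of the weight. *)
Definition cube (R : realType) (n : nat) (p : 'rV[R]_n) (l : R) : set 'rV[R]_n :=
  [set v | forall i, `[p ord0 i - 2 * l, p ord0 i + 2 * l]%classic (v ord0 i)].

Lemma compact_cube (R : realType) (n : nat) (p : 'rV[R]_n) (l : R) :
  compact (cube p l).
Proof.
apply: (@rV_compact _ _ (fun i =>
  `[p ord0 i - 2 * l, p ord0 i + 2 * l]%classic)) => i; exact: segment_compact.
Qed.

Lemma ball_sub_cube (R : realType) (n : nat) (p : 'rV[R]_n) (l : R) x :
  0 < l -> `|x - p| < 2 * l -> cube p l x.
Proof.
move=> l0; rewrite rV_norm_lt ?mulr_gt0// => /forallP H i /=.
by have := H i; rewrite !mxE ltr_distl in_itv/= => /andP[/ltW -> /ltW ->].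
Qed.

Definition bumpI (R : realType) (n : nat) (p : 'rV[R]_n) (l : R)
  (g : 'rV[R]_n -> R) : R := \int[lebesgue_rV R n]_x (g x * cubebump p l x).

Section bumpI.
Context {R : realType} {n : nat}.
Implicit Types (p : 'rV[R]_n) (l : R) (g : 'rV[R]_n -> R).

Lemma bump_integrable p l g : 0 < l -> continuous g ->
  (lebesgue_rV R n).-integrable setT (EFin \o (fun x => g x * cubebump p l x)).
Proof.
move=> l0 cg; set Q := [set x : 'rV[R]_n | `|x - p| < 2 * l].
have mQ : measurable Q by exact: measurable_rV_ball.
have Qfin : (lebesgue_rV R n Q < +oo)%E.
  by rewrite lebesgue_rV_ball ?mulr_gt0// ltry.
have mg : measurable_fun setT (fun x => g x * cubebump p l x).
  apply: measurable_funM; first exact: continuous_measurable_rV.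
  exact: measurable_cubebump.
rewrite (_ : EFin \o _ = (EFin \o (fun x => g x * cubebump p l x)) \_ Q); last first.
  apply/funext => x; rewrite patchE; case: ifPn => //.
  by rewrite notin_setE => xQ /=; rewrite cubebump_eq0// mulr0.
apply/(integrable_mkcond _ mQ).
apply: (measurable_bounded_integrable mQ).
- exact: Qfin.
- exact: measurable_funTS.
have [M [_ HM]] : bounded_set (g @` cube p l).
  apply: compact_bounded; apply: (@continuous_compact _ _ g (cube p l)).
    exact: continuous_subspaceT.
  exact: compact_cube.
exists M; split; first exact: num_real.
move=> M' MM' x Qx; rewrite /= normrM (ger0_norm (cubebump_ge0 _ _ _)).
rewrite (@le_trans _ _ `|g x|)//; first by rewrite ler_piMr// cubebump_le1.
by apply: HM => //; exists x => //; exact: ball_sub_cube.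
Qed.

Lemma bumpI_le p l g1 g2 : 0 < l -> continuous g1 -> continuous g2 ->
  (forall x, cube p l x -> g1 x <= g2 x) -> bumpI p l g1 <= bumpI p l g2.
Proof.
move=> l0 c1 c2 g12; apply: le_Rintegral => //; try exact: bump_integrable.
move=> x _; have [->|/eqP] := eqVneq (cubebump p l x) 0; first by rewrite !mulr0.
move=> /(contra_notP (@cubebump_eq0 _ _ p l x l0)) xQ.
by rewrite ler_wpM2r ?cubebump_ge0// g12//; exact: ball_sub_cube.
Qed.

Lemma bumpID p l g1 g2 : 0 < l -> continuous g1 -> continuous g2 ->
  bumpI p l (fun x => g1 x + g2 x) = bumpI p l g1 + bumpI p l g2.
Proof.
move=> l0 c1 c2; rewrite /bumpI -RintegralD//; try exact: bump_integrable.
by apply: eq_Rintegral => x _; rewrite mulrDl.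
Qed.

Lemma bumpIZ p l k g : 0 < l -> continuous g ->
  bumpI p l (fun x => k * g x) = k * bumpI p l g.
Proof.
move=> l0 cg; rewrite /bumpI -RintegralZl//; last exact: bump_integrable.
by apply: eq_Rintegral => x _; rewrite mulrA.
Qed.

Lemma continuous_cstM (k : R) g : continuous g -> continuous (fun x => k * g x).
Proof.
move=> cg x.
exact: (@continuousM _ _ (fun=> k) g x (@cst_continuous _ _ k x) (cg x)).
Qed.

Lemma continuous_plus g1 g2 : continuous g1 -> continuous g2 ->
  continuous (fun x => g1 x + g2 x).
Proof. by move=> c1 c2 x; exact: (@continuousD _ _ _ g1 g2 x (c1 x) (c2 x)). Qed.

Lemma continuous_sumr (I : Type) (s : seq I) (G : I -> 'rV[R]_n -> R) :
  (forall i, continuous (G i)) -> continuous (fun x => \sum_(i <- s) G i x).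
Proof.
move=> cG; elim: s => [|i s IH].
  by under eq_fun do rewrite big_nil; exact: cst_continuous.
under eq_fun do rewrite big_cons.
exact: continuous_plus.
Qed.

Lemma bumpI_sum p l (I : Type) (s : seq I) (G : I -> 'rV[R]_n -> R) : 0 < l ->
  (forall i, continuous (G i)) ->
  bumpI p l (fun x => \sum_(i <- s) G i x) = \sum_(i <- s) bumpI p l (G i).
Proof.
move=> l0 cG; elim: s => [|i s IH].
  have c1 : continuous ((fun=> 1) : 'rV[R]_n -> R) by exact: cst_continuous.
  rewrite [RHS]big_nil -[RHS](mul0r (bumpI p l (fun=> 1))) -bumpIZ//.
  by apply: eq_Rintegral => x _; rewrite big_nil mul0r.
rewrite big_cons -IH -bumpID//; last exact: continuous_sumr.
by apply: eq_Rintegral => x _; rewrite big_cons.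
Qed.

(** The weight is translated along, by invariance of Lebesgue measure. *)
Lemma bumpI_addr p l v g : (forall x, 0 <= g x) -> continuous g ->
  bumpI p l (fun x => g (x + v)) = bumpI (p + v) l g.
Proof.
move=> g0 cg; rewrite /bumpI /Rintegral; congr fine.
rewrite -[RHS](ge0_integral_rV_add v).
- apply: eq_integral => x _; congr (_ * _)%:E.
  by apply: eq_bigr => i _; rewrite !mxE; congr (cosbump (_ / _)); ring.
- apply/measurable_EFinP; apply: measurable_funM; last exact: measurable_cubebump.
  exact: continuous_measurable_rV.
- by move=> x; rewrite lee_fin mulr_ge0// cubebump_ge0.
Qed.

Lemma continuous_addr (v : 'rV[R]_n) g : continuous g ->
  continuous (fun x : 'rV[R]_n => g (x + v)).
Proof.
move=> cg x U /(cg (x + v)) /nbhs_ballP[e e0 eU].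
apply/nbhs_ballP; exists e => // y xy; apply: eU.
by move: xy; rewrite -!ball_normE/= opprD addrACA subrr addr0.
Qed.

(** Discrete integration by parts: translation invariance moves second
    differences from the function to the weight. *)
Lemma bumpI_second_diff p l h i g : 0 < l -> 0 < h -> h < 2 * l ->
  (forall x, 0 <= g x) -> continuous g ->
  2 * bumpI p l g <= bumpI p l (fun x => g (x + h *: delta_mx ord0 i))
    + bumpI p l (fun x => g (x - h *: delta_mx ord0 i))
    + (h / l) ^+ 2 * bumpI p l g.
Proof.
move=> l0 h0 hl g0 cg; set v := h *: delta_mx ord0 i.
rewrite !bumpI_addr// /bumpI -!RintegralZl//; try exact: bump_integrable.
have int1 := bump_integrable (p + v) l0 cg.
have int2 := bump_integrable (p - v) l0 cg.
have int3 := bump_integrable p l0 cg.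
have intZ k : (lebesgue_rV R n).-integrable setT
    (EFin \o (fun x => k * (g x * cubebump p l x))).
  have := integrableZl measurableT k int3.
  by apply: eq_integrable => // x _; rewrite /= EFinM.
have int12 : (lebesgue_rV R n).-integrable setT (EFin \o (fun x =>
    g x * cubebump (p + v) l x + g x * cubebump (p - v) l x)).
  have := integrableD measurableT int1 int2.
  by apply: eq_integrable => // x _; rewrite /= EFinD.
rewrite -RintegralD// -RintegralD//; apply: le_Rintegral => //.
  have := integrableD measurableT int12 (intZ ((h / l) ^+ 2)).
  by apply: eq_integrable => // x _; rewrite /= EFinD.
move=> x _.
have E w : cubebump (p + w) l x = cubebump p l (x - w).
  by apply: eq_bigr => j _; rewrite !mxE; congr (cosbump (_ / _)); ring.
rewrite !E opprK.
have := @cubebump_second_diff R n p l h i x l0 h0 hl.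
rewrite -/v => /(ler_wpM2l (g0 x)); lra.
Qed.

Lemma bumpI1_gt0 p l : 0 < l -> 0 < bumpI p l (fun=> 1).
Proof.
move=> l0; pose B := [set x : 'rV[R]_n | `|x - p| < l].
have mB : measurable B by exact: measurable_rV_ball.
have c0 : 0 < cos (1 : R) ^+ n by rewrite exprn_gt0// cos1_gt0.
rewrite -lte_fin /bumpI /Rintegral fineK; last first.
  apply: integrable_fin_num => //; apply: bump_integrable => //.
  exact: cst_continuous.
apply: (@lt_le_trans _ _ (\int[lebesgue_rV R n]_(x in B) (cos 1 ^+ n)%:E)%E).
  rewrite integral_cst// [X in (_ * X)%E](_ : _ = ((2 * l) ^+ n)%:E); last first.
    exact: lebesgue_rV_ball.
  rewrite -EFinM lte_fin mulr_gt0//.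
  by rewrite exprn_gt0// mulr_gt0.
have m1 : measurable_fun setT (fun x : 'rV[R]_n => (1 * cubebump p l x)%:E).
  apply/measurable_EFinP; apply: measurable_funM; first exact: measurable_cst.
  exact: measurable_cubebump.
apply: (@le_trans _ _ (\int[lebesgue_rV R n]_(x in B) (1 * cubebump p l x)%:E)%E).
  apply: ge0_le_integral => //.
  - by move=> x _; rewrite lee_fin ltW.
  - exact: measurable_funTS.
  move=> x /=; rewrite /B/= rV_norm_lt// => /forallP xB; rewrite mul1r lee_fin.
  rewrite -[X in _ ^+ X]card_ord -prodr_const; apply: ler_prod => i _.
  rewrite (ltW (cos1_gt0 _))/=; apply: cosbump_ge_cos1.
  rewrite normrM normfV (gtr0_norm l0) ltr_pdivrMr// mul1r.
  by have := xB i; rewrite !mxE.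
apply: ge0_subset_integral => // x _.
by rewrite lee_fin mul1r cubebump_ge0.
Qed.

End bumpI.

(** * Second differences and uniform limits *)

Lemma is_derive_line (R : realType) (n : nat) (g : 'rV[R]_n -> R) (x e : 'rV[R]_n)
    (s : R) : derivable g (x + s *: e) e ->
  is_derive s 1 (fun s => g (x + s *: e)) ('D_e g (x + s *: e)).
Proof.
move=> dg.
have E : (fun h : R => h^-1 *: (g (x + (h *: 1 + s) *: e) - g (x + s *: e))) =
    (fun h : R => h^-1 *: (g (h *: e + (x + s *: e)) - g (x + s *: e))).
  apply/funext => h; congr (_ *: (g _ - _)).
  by rewrite [h *: 1]mulr1 scalerDl addrCA.
apply: DeriveDef.
  by rewrite /derivable /= E; exact: dg.
by rewrite /derive /= E.
Qed.

(** The function [s |-> G s + G (- s) - M * s ^ 2] is nonincreasing for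
    [0 <= s <= h], because the mean value theorem for [dG] on [- s, s] bounds
    its derivative [dG s - dG (- s) - 2 * M * s] by [0]. *)
Lemma second_diff_le (R : realType) (G dG ddG : R -> R) (h M : R) : 0 < h ->
  (forall s : R, `|s| <= h -> is_derive s 1 G (dG s)) ->
  (forall s : R, `|s| <= h -> is_derive s 1 dG (ddG s)) ->
  (forall s, `|s| <= h -> ddG s <= M) ->
  G h + G (- h) - 2 * G 0 <= M * h ^+ 2.
Proof.
move=> h0 d1 d2 ddM.
pose P s := G s + G (- s) - M * (s * s).
pose dP s := dG s - dG (- s) - M * (2 * s).
have abs s : 0 <= s -> s <= h -> `|s| <= h by move=> s0; rewrite ger0_norm.
have dPd (s : R) : `|s| <= h -> is_derive s 1 P (dP s).
  move=> sh; have dGs := d1 s sh.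
  have dGNs : is_derive s 1 (fun s => G (- s)) (- dG (- s)).
    have H : is_derive (- s) 1 G (dG (- s)) by apply: d1; rewrite normrN.
    have H' := @is_derive1_comp R G -%R s _ _ H (is_deriveNid s 1).
    by apply: is_derive_eq H' _; rewrite mulrN1.
  have dsq : is_derive s 1 (fun s => M * (s * s)) (M * (2 * s)).
    have H := @is_deriveM R R id id s 1 1 1 (is_derive_id s 1) (is_derive_id s 1).
    have H' := @is_deriveM R R (cst M) _ s 1 0 _ (is_derive_cst M s 1) H.
    by apply: is_derive_eq H' _; rewrite /GRing.scale/=; ring.
  have := is_deriveB (is_deriveD dGs dGNs) dsq.
  by move=> H; apply: is_derive_eq H _.
have cP : {within `[0, h], continuous P}.
  apply: derivable_within_continuous => s; rewrite in_itv/= => /andP[s0 sh].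
  by have [] := dPd s (abs s s0 sh).
have [|c] := @MVT R P dP 0 h h0 _ cP.
  by move=> s; rewrite in_itv/= => /andP[s0 sh]; apply: dPd; apply: abs; exact: ltW.
rewrite in_itv/= => /andP[c0 ch] E.
have cc : - c < c by lra.
have cdG : {within `[- c, c], continuous dG}.
  apply: derivable_within_continuous => s; rewrite in_itv/= => /andP[s0 sh].
  have sh' : `|s| <= h by rewrite ler_norml; lra.
  by have [] := d2 s sh'.
have [|z] := @MVT R dG ddG (- c) c cc _ cdG.
  move=> s; rewrite in_itv/= => /andP[s0 sh].
  by apply: d2; rewrite ler_norml; lra.
rewrite in_itv/= => /andP[z0 zh] E2.
have zM : ddG z <= M by apply: ddM; rewrite ler_norml; lra.
have dP0 : dP c <= 0.
  rewrite /dP E2; have c20 : 0 <= c - - c by lra.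
  have := ler_wpM2r c20 zM; lra.
have : P h - P 0 <= 0.
  by rewrite E subr0 mulr_le0_ge0// ltW.
rewrite /P oppr0 expr2; lra.
Qed.

(** Joint continuity on a compact set times a point gives uniformity in the
    first variable; this makes difference quotients converge uniformly on the
    support of the weight. *)
Lemma compact_uniform_near (R : realType) (n : nat) (Psi : R -> 'rV[R]_n -> R)
    (K : set 'rV[R]_n) (t e : R) : compact K -> 0 < e ->
  (forall x, K x -> {for (x, t), continuous (fun z : 'rV[R]_n * R => Psi z.2 z.1)}) ->
  exists2 d : R, 0 < d &
    forall x s, K x -> `|s - t| < d -> `|Psi s x - Psi t x| <= e.
Proof.
move=> /compact_near_coveringP cK e0 cPsi.
have := cK R (nbhs t) (fun s x => `|Psi s x - Psi t x| <= e) _.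
move=> /(_ _) H.
have {}H : \forall s \near t, K `<=` (fun x => `|Psi s x - Psi t x| <= e).
  apply: H => x Kx.
  have e20 : 0 < e / 2 by rewrite divr_gt0.
  have /cvgrPdist_lt/(_ _ e20) := cPsi x Kx.
  move=> [[U V]/= [Ux Vt] UV].
  exists (U, V) => // -[x' s] /= [Ux' Vs].
  have /= H1 := UV (x', s) (conj Ux' Vs).
  have /= H2 := UV (x', t) (conj Ux' (nbhs_singleton Vt)).
  have -> : Psi s x' - Psi t x' = (Psi t x - Psi t x') - (Psi t x - Psi s x').
    by ring.
  rewrite (le_trans (ler_normB _ _))//; lra.
have [d /= d0 dH] := (nbhs_ballP _ _).1 H.
exists d => // x s Kx sd; apply: (dH s) => //.
by rewrite -ball_normE/= distrC.
Qed.

Lemma normr_scale_delta (R : realType) (n : nat) (h : R) (i : 'I_n) :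
  `|h *: delta_mx ord0 i : 'rV[R]_n| <= `|h|.
Proof.
rewrite [leLHS]/Num.norm /= mx_normrE; apply/bigmax_leP; split => // -[j k] _ /=.
rewrite !mxE; case: (_ && _) => /=; first by rewrite mulr1.
by rewrite mulr0 normr0.
Qed.

(** Weak form of [phi'' >= - l ^ (- 2) * phi], where [phi] is the weight and
    the derivatives are along the [i]-th axis.  It is the limit of
    [bumpI_second_diff]: second difference quotients of [g] exceed the second
    derivative by at most [eps], uniformly on the support of the weight. *)
Lemma bumpI_partial2 (R : realType) (n : nat) (p : 'rV[R]_n) (l : R) (i : 'I_n)
    (g : 'rV[R]_n -> R) : 0 < l -> (forall x, 0 <= g x) -> continuous g ->
  (forall x, derivable g x (delta_mx ord0 i)) ->
  (forall x, derivable (partial i g) x (delta_mx ord0 i)) ->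
  continuous (partial i (partial i g)) ->
  - (l ^- 2 * bumpI p l g) <= bumpI p l (partial i (partial i g)).
Proof.
move=> l0 g0 cg d1 d2 c2; set psi := partial i (partial i g).
pose e : 'rV[R]_n := delta_mx ord0 i.
have Z0 := bumpI1_gt0 p l0; set Z := bumpI p l (fun=> 1) in Z0.
apply/ler_addgt0Pr => e' e'0.
pose eps := e' / Z; have eps0 : 0 < eps by rewrite divr_gt0.
have [d d0 dH] : exists2 d : R, 0 < d & forall x s, cube p l x -> `|s - 0| < d ->
    `|psi (x + s *: e) - psi (x + 0 *: e)| <= eps.
  apply: (@compact_uniform_near R n (fun s x => psi (x + s *: e))) => //.
    exact: compact_cube.
  move=> x _ U /=; rewrite scale0r addr0 => /c2 /nbhs_ballP[r /= r0 rU].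
  have r20 : 0 < r / 2 by rewrite divr_gt0.
  exists (ball x (r / 2), ball (0 : R) (r / 2)).
    by split; [exact: (nbhsx_ballx x _ r20)|exact: (nbhsx_ballx _ _ r20)].
  move=> [y s] /= [xy sr]; apply: rU.
  move: xy sr; rewrite -!ball_normE/= sub0r normrN opprD addrA => xy sr.
  rewrite (le_lt_trans (ler_normB _ _))// [ltRHS]splitr ltrD//.
  exact: le_lt_trans (normr_scale_delta _ _) sr.
pose h := Num.min (d / 2) l.
have h0 : 0 < h by rewrite lt_min l0 divr_gt0.
have hl : h < 2 * l by rewrite gt_min; apply/orP; right; lra.
have hd : h < d by rewrite gt_min; apply/orP; left; lra.
have pt x : cube p l x ->
    g (x + h *: e) + g (x - h *: e) <= 2 * g x + h ^+ 2 * (psi x + eps).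
  move=> Kx.
  have := @second_diff_le R (fun s => g (x + s *: e))
    (fun s => partial i g (x + s *: e)) (fun s => psi (x + s *: e)) h (psi x + eps) h0.
  rewrite scale0r addr0 scaleNr => H; rewrite -lerBlDl [leRHS]mulrC; apply: H.
  - by move=> s _; exact: is_derive_line.
  - by move=> s _; exact: is_derive_line.
  - move=> s sh; have := dH x s Kx; rewrite subr0 scale0r addr0.
    by move=> /(_ (le_lt_trans sh hd)); rewrite ler_distl => /andP[].
have c1 : continuous ((fun=> 1) : 'rV[R]_n -> R) by exact: cst_continuous.
have ca (v : 'rV[R]_n) : continuous (fun x : 'rV[R]_n => g (x + v)) by exact: continuous_addr.
have := @bumpI_second_diff R n p l h i g l0 h0 hl g0 cg.
rewrite -bumpID// => H1.
have : bumpI p l (fun x => g (x + h *: e) + g (x - h *: e)) <=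
    2 * bumpI p l g + h ^+ 2 * (bumpI p l psi + eps * Z).
  have ce : continuous (fun x : 'rV[R]_n => eps * 1) by exact: cst_continuous.
  have cpe : continuous (fun x => psi x + eps * 1) by exact: continuous_plus.
  have <- : bumpI p l (fun x => 2 * g x + h ^+ 2 * (psi x + eps * 1)) =
      2 * bumpI p l g + h ^+ 2 * (bumpI p l psi + eps * Z).
    rewrite bumpID//; [|exact: continuous_cstM|exact: continuous_cstM].
    by rewrite bumpIZ// (bumpIZ p _ l0 cpe) bumpID// (bumpIZ p eps l0 c1).
  apply: bumpI_le => //; [exact: continuous_plus|apply: continuous_plus; exact: continuous_cstM|].
  by move=> x Kx; rewrite (le_trans (pt x Kx))// mulr1.
have -> : eps * Z = e' by rewrite divfK// gt_eqF.
rewrite -/e in H1 => H2; have H3 := le_trans H1 (lerD H2 (lexx _)).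
have h20 : 0 < h ^+ 2 by rewrite exprn_gt0.
rewrite lerNl -subr_ge0 -(pmulr_rge0 _ h20).
rewrite -subr_ge0 in H3; apply: le_trans H3 _; rewrite le_eqVlt; apply/orP; left.
by apply/eqP; rewrite expr_div_n; ring.
Qed.

(** * The differential inequality for the mean of a solution *)

Lemma bumpI_dist (R : realType) (n : nat) (p : 'rV[R]_n) (l e : R)
    (g1 g2 : 'rV[R]_n -> R) : 0 < l -> continuous g1 -> continuous g2 ->
  (forall x, cube p l x -> `|g1 x - g2 x| <= e) ->
  `|bumpI p l g1 - bumpI p l g2| <= e * bumpI p l (fun=> 1).
Proof.
move=> l0 c1 c2 g12.
have ce (k : R) : continuous ((fun=> k * 1) : 'rV[R]_n -> R) by exact: cst_continuous.
have c11 : continuous ((fun=> 1) : 'rV[R]_n -> R) by exact: cst_continuous.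
rewrite ler_distl -(bumpIZ _ _ l0 c11) lerBlDr -!bumpID//.
by apply/andP; split; apply: bumpI_le => //; do ?[exact: continuous_plus] => x /g12;
  rewrite ler_distl mulr1 lerBlDr => /andP[].
Qed.

Lemma MVT_two_sided (R : realType) (F dF : R -> R) (t h : R) :
  (forall s : R, `|s - t| <= `|h| -> is_derive s 1 F (dF s)) ->
  exists2 c, `|c - t| <= `|h| & F (h + t) - F t = dF c * h.
Proof.
move=> dFd.
have [h0|h0|->] := ltgtP h 0; last first.
- by exists t; rewrite ?subrr ?normr0// add0r subrr mulr0.
- have ht : t < h + t by rewrite ltrDr.
  have In s : s \in `[t, h + t] -> `|s - t| <= `|h|.
    rewrite in_itv/= => /andP[ts sh]; rewrite (gtr0_norm h0) ger0_norm; lra.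
  have [||c ct E] := @MVT R F dF t (h + t) ht.
  + by move=> s sth; apply: dFd; apply: In; exact: subset_itv_oo_cc.
  + by apply: derivable_within_continuous => s /In/dFd[].
  + exists c; first by apply: In; exact: subset_itv_oo_cc.
    by rewrite E addrK.
- have ht : h + t < t by rewrite gtrDr.
  have In s : s \in `[h + t, t] -> `|s - t| <= `|h|.
    rewrite in_itv/= => /andP[ts sh]; rewrite (ltr0_norm h0) ler0_norm; lra.
  have [||c ct E] := @MVT R F dF (h + t) t ht.
  + by move=> s sth; apply: dFd; apply: In; exact: subset_itv_oo_cc.
  + by apply: derivable_within_continuous => s /In/dFd[].
  + exists c; first by apply: In; exact: subset_itv_oo_cc.
    by rewrite -[LHS]opprB E; ring.
Qed.

Lemma continuous_slice (R : realType) (n : nat) (T t : R)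
    (Phi : 'rV[R]_n * R -> R) :
  {in [set z : 'rV[R]_n * R | 0 < z.2 < T], continuous Phi} -> 0 < t < T ->
  continuous (fun x => Phi (x, t)).
Proof.
move=> cPhi tT x U.
have xtD : (x, t) \in [set z : 'rV[R]_n * R | 0 < z.2 < T] by rewrite inE.
move=> /(cPhi _ xtD) [[A B] /= [xA tB] AB].
apply: filterS xA => y Ay /=; apply: (AB (y, t)); split => //=.
exact: nbhs_singleton.
Qed.

(** By the mean value theorem, difference quotients in time are values of the
    time derivative, which is uniformly close to its value at [t]. *)
Lemma bumpI_is_derive (R : realType) (n : nat) (p : 'rV[R]_n) (l T t : R)
    (u : R -> 'rV[R]_n -> R) : 0 < l -> C21 T u -> 0 < t < T ->
  is_derive t 1 (fun s => bumpI p l (u s)) (bumpI p l (fun x => derive1 (u ^~ x) t)).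
Proof.
move=> l0 [du [cu cut _ _]] /andP[t0 tT].
have tT' : 0 < t < T by rewrite t0.
have Z0 := bumpI1_gt0 p l0; set Z := bumpI p l (fun=> 1) in Z0.
have cus s : 0 < s < T -> continuous (u s).
  by move=> sT; exact: (continuous_slice cu sT).
have cuts s : 0 < s < T -> continuous (fun x => derive1 (u ^~ x) s).
  by move=> sT; exact: (continuous_slice cut sT).
set J := bumpI p l (fun x => derive1 _ _).
suff H : h^-1 *: (bumpI p l (u (h *: 1 + t)) - bumpI p l (u t)) @[h --> 0^'] --> J.
  by apply: DeriveDef; [exact: cvgP H|exact/cvg_lim].
apply/cvgrPdist_le => e e0.
pose eps := e / Z; have eps0 : 0 < eps by rewrite divr_gt0.
have [d d0 dH] : exists2 d : R, 0 < d & forall x s, cube p l x -> `|s - t| < d ->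
    `|derive1 (u ^~ x) s - derive1 (u ^~ x) t| <= eps.
  apply: (@compact_uniform_near R n (fun s x => derive1 (u ^~ x) s)) => //.
    exact: compact_cube.
  by move=> x _; apply: cut; rewrite inE.
pose r := Num.min d (Num.min t (T - t)).
have r0 : 0 < r by rewrite !lt_min d0 t0 subr_gt0.
apply/nbhs_ballP; exists r => //= h.
rewrite /ball/= sub0r normrN => hr h0.
have [hd ht hT] : [/\ `|h| < d, `|h| < t & `|h| < T - t].
  by move: hr; rewrite !lt_min => /andP[-> /andP[-> ->]].
have inT s : `|s - t| <= `|h| -> 0 < s < T.
  rewrite ler_distl => /andP[H1 H2]; apply/andP; split; lra.
have htT : 0 < h + t < T by apply: inT; rewrite addrK.
rewrite [h%:A]mulr1.
have c1 := cus _ htT; have c2 := cus _ tT'.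
have cN : continuous (fun x => -1 * u t x) by exact: continuous_cstM.
have cB : continuous (fun x => u (h + t) x + -1 * u t x) by exact: continuous_plus.
have cQ : continuous (fun x => h^-1 * (u (h + t) x + -1 * u t x)).
  exact: continuous_cstM.
have -> : h^-1 *: (bumpI p l (u (h + t)) - bumpI p l (u t)) =
    bumpI p l (fun x => h^-1 * (u (h + t) x + -1 * u t x)).
  by rewrite bumpIZ// bumpID// bumpIZ// mulN1r.
have -> : e = eps * Z by rewrite /eps divfK// gt_eqF.
apply: bumpI_dist => //; first exact: cuts.
move=> x Kx.
have [|c ch E] := @MVT_two_sided R (u ^~ x) (fun s => derive1 (u ^~ x) s) t h.
  move=> s /inT sT; have [dd _ _] := du x s sT.
  by apply: DeriveDef => //; rewrite derive1E.
rewrite mulN1r E mulrA [h^-1 * _]mulrC -mulrA mulVf// mulr1 distrC.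
by apply: dH => //; exact: le_lt_trans hd.
Qed.

(** While [y >= c], the function [F o y] decreases at rate at least [1 / 8],
    and it starts below [F c] and stays positive.  The bound [y >= c] persists
    because the maximum of [y] over [[t1, t]] can only be attained at [t]: at
    the maximum [y >= c], so [y] is still growing there. *)
Lemma blowup_time_le (R : realType) (f y dy : R -> R) (c t1 t2 : R) :
  C1_halfline f ->
  (forall s, 0 < s -> 0 < f s) -> (forall s, 0 < s -> 0 < derive1 f s) ->
  (forall s, 0 < s -> (F_tail f s < +oo)%E) -> 0 < c -> t1 < t2 ->
  (forall t, t1 <= t <= t2 -> is_derive t 1 y (dy t)) ->
  (forall t, t1 <= t <= t2 -> c <= y t -> f (y t) / 8 <= dy t) ->
  c <= y t1 -> t2 - t1 <= 8 * Ftail f c.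
Proof.
move=> fC1 f0 df0 Ffin c0 t12 yd yineq yc.
have cy a b : t1 <= a -> b <= t2 -> {within `[a, b], continuous y}.
  move=> ta bt; apply: derivable_within_continuous => s.
  rewrite in_itv/= => /andP[as_ sb].
  by have [] := yd s ltac:(by rewrite (le_trans ta as_) (le_trans sb bt)).
have stay t : t1 <= t <= t2 -> c <= y t.
  move=> /andP[t1t tt2].
  have [m] := EVT_max t1t (cy _ _ (lexx _) tt2).
  rewrite in_itv/= => /andP[t1m mt] maxm.
  have ym : c <= y m by rewrite (le_trans yc)// maxm// in_itv/= lexx.
  have mI : t1 <= m <= t2 by rewrite t1m (le_trans mt).
  move: mt; rewrite le_eqVlt => /predU1P[<-//|mt]; exfalso.
  have dy0 : 0 < dy m.
    apply: lt_le_trans (yineq m mI ym).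
    by rewrite divr_gt0// f0// (lt_le_trans c0).
  have [ydm ydE] := yd m mI.
  have /cvgrPdist_lt/(_ _ dy0) : h^-1 *: (y (h *: 1 + m) - y m) @[h --> 0^'] --> dy m.
    by rewrite -ydE; exact: ydm.
  move=> /nbhs_ballP[d /= d0 dH].
  pose h := Num.min (d / 2) (t - m).
  have h0 : 0 < h by rewrite lt_min subr_gt0 mt divr_gt0.
  have hd : h < d by rewrite gt_min; apply/orP; left; lra.
  have htm : h + m <= t by rewrite -lerBrDr ge_min lexx orbT.
  have := dH h; rewrite /ball/= sub0r normrN gtr0_norm// => /(_ hd).
  rewrite gt_eqF// [h%:A]mulr1 => /(_ isT).
  have yhm : y (h + m) <= y m by apply: maxm; rewrite in_itv/=; apply/andP; split; lra.
  have : h^-1 * (y (h + m) - y m) <= 0.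
    by rewrite pmulr_rle0 ?invr_gt0// subr_le0.
  rewrite /GRing.scale/= ltr_norml => H /andP[_]; lra.
have ypos t : t1 <= t <= t2 -> 0 < y t by move=> /stay; exact: lt_le_trans.
have Gd (t : R) : t1 <= t <= t2 ->
    is_derive t 1 (Ftail f \o y) (- (f (y t))^-1 * dy t).
  move=> tI; apply: is_derive1_comp; last exact: yd.
  exact: Ftail_is_derive fC1 f0 df0 Ffin _ (ypos t tI).
have [||z] := @MVT R (Ftail f \o y) (fun t => - (f (y t))^-1 * dy t) t1 t2 t12.
- by move=> t; rewrite in_itv/= => /andP[H1 H2]; apply: Gd; rewrite !ltW.
- apply: derivable_within_continuous => s; rewrite in_itv/= => sI.
  by have [] := Gd s sI.
rewrite in_itv/= => /andP[z1 z2] /= E.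
have zI : t1 <= z <= t2 by rewrite !ltW.
have fz0 := f0 _ (ypos z zI).
have H1 : 1 / 8 <= (f (y z))^-1 * dy z.
  by rewrite [leRHS]mulrC ler_pdivlMr// mul1r mulrC; exact: yineq zI (stay z zI).
have F2 := Ftail_gt0 fC1 f0 df0 Ffin (ypos t2 ltac:(by rewrite lexx ltW)).
have F1 : Ftail f (y t1) <= Ftail f c by exact: Ftail_le.
have t210 : 0 <= t2 - t1 by rewrite subr_ge0 ltW.
have := ler_wpM2r t210 H1; rewrite mulNr mulNr in E; lra.
Qed.

(** Jensen's inequality in the form needed here: the line below [f] is
    integrated against the weight, and its linear part cancels at the mean
    [y]. *)
Lemma bumpI_solution_ineq (R : realType) (n : nat) (f : R -> R) (T t l y m : R)
    (p : 'rV[R]_n) (u : R -> 'rV[R]_n -> R) : 0 < l ->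
  nonneg_classical_solution f T u -> 0 < t < T ->
  (forall s, 0 <= s -> f y / 4 + m * (s - y) <= f s) ->
  bumpI p l (u t) = y * bumpI p l (fun=> 1) ->
  f y / 4 * bumpI p l (fun=> 1) - n%:R * l ^- 2 * bumpI p l (u t) <=
  bumpI p l (fun x => derive1 (u ^~ x) t).
Proof.
move=> l0 [[du [cu cut _ cpp]] u0 ueq] tT sup yE.
set Z := bumpI p l (fun=> 1).
have c1 : continuous ((fun=> 1) : 'rV[R]_n -> R) by exact: cst_continuous.
have cus : continuous (u t) by exact: (continuous_slice cu tT).
have cuts : continuous (fun x => derive1 (u ^~ x) t).
  exact: (continuous_slice cut tT).
have cpps i : continuous (partial i (partial i (u t))).
  exact: (continuous_slice (cpp i i) tT).
have clap : continuous (laplacian (u t)) by exact: continuous_sumr.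
have fuE : (fun x => f (u t x)) =
    (fun x => derive1 (u ^~ x) t + -1 * laplacian (u t) x).
  by apply/funext => x; rewrite ueq// mulN1r addrAC subrr add0r.
have cfu : continuous (fun x => f (u t x)).
  by rewrite fuE; apply: continuous_plus => //; exact: continuous_cstM.
have -> : bumpI p l (fun x => derive1 (u ^~ x) t) =
    bumpI p l (laplacian (u t)) + bumpI p l (fun x => f (u t x)).
  by rewrite -bumpID//; congr bumpI; apply/funext => x; exact: ueq.
rewrite [leLHS]addrC lerD//.
  rewrite bumpI_sum// -mulrA mulr_natl -mulNrn.
  rewrite -[X in _ *+ X]card_ord -sumr_const; apply: ler_sum => i _.
  have ut0 x : 0 <= u t x by exact: u0.
  have d1 x : derivable (u t) x (delta_mx ord0 i).
    by have [_ + _] := du x t tT; apply.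
  have d2 x : derivable (partial i (u t)) x (delta_mx ord0 i).
    by have [_ _] := du x t tT; apply.
  exact: (bumpI_partial2 p l0 ut0 cus d1 d2 (cpps i)).
have cl : continuous (fun x => (f y / 4 - m * y) * 1 + m * u t x).
  by apply: continuous_plus; exact: continuous_cstM.
have -> : f y / 4 * Z = bumpI p l (fun x => (f y / 4 - m * y) * 1 + m * u t x).
  rewrite bumpID//; [|exact: continuous_cstM|exact: continuous_cstM].
  by rewrite (bumpIZ _ _ l0 c1) (bumpIZ _ _ l0 cus) yE -/Z; ring.
apply: bumpI_le => // x _; apply: le_trans (sup _ (u0 x t tT)).
by rewrite le_eqVlt; apply/orP; left; apply/eqP; ring.
Qed.

(** The hypothesis comparing [y] with [f y * l ^ 2] makes the loss by diffusion
    at most half of the gain [f y / 4]. *)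
Lemma solution_lifespan_le (R : realType) (n : nat) (f m : R -> R)
    (T t1 t2 l c : R) (p : 'rV[R]_n) (u : R -> 'rV[R]_n -> R) :
  C1_halfline f ->
  (forall s, 0 < s -> 0 < f s) -> (forall s, 0 < s -> 0 < derive1 f s) ->
  (forall s, 0 < s -> (F_tail f s < +oo)%E) ->
  (forall y s, c <= y -> 0 <= s -> f y / 4 + m y * (s - y) <= f s) ->
  0 < c -> 0 < l ->
  (forall y, c <= y -> 8 * n%:R * y <= f y * l ^+ 2) ->
  nonneg_classical_solution f T u -> 0 < t1 -> t1 < t2 -> t2 < T ->
  c * bumpI p l (fun=> 1) <= bumpI p l (u t1) ->
  t2 - t1 <= 8 * Ftail f c.
Proof.
move=> fC1 f0 df0 Ffin sup c0 l0 fl sol t10 t12 t2T.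
have Z0 := bumpI1_gt0 p l0; set Z := bumpI p l (fun=> 1) in Z0 *.
move=> cZ.
pose y s := Z^-1 * bumpI p l (u s).
pose dy s := Z^-1 * bumpI p l (fun x => derive1 (u ^~ x) s).
have tI t : t1 <= t <= t2 -> 0 < t < T.
  by move=> /andP[H1 H2]; rewrite (lt_le_trans t10 H1) (le_lt_trans H2 t2T).
have yE t : bumpI p l (u t) = y t * Z by rewrite /y mulrC mulrA divff ?mul1r// gt_eqF.
apply: (@blowup_time_le R f y dy) => //.
- move=> t /tI tT; have [uC _ _] := sol.
  have H := bumpI_is_derive p l0 uC tT.
  have H' := @is_deriveM R R (cst Z^-1) _ t 1 0 _ (is_derive_cst Z^-1 t 1) H.
  by apply: is_derive_eq H' _; rewrite /GRing.scale/= mulr0 addr0.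
- move=> t /tI tT cy.
  have := bumpI_solution_ineq l0 sol tT (fun s => sup (y t) s cy) (yE t).
  rewrite -/Z => H; rewrite /dy -(ler_pM2l Z0) [leRHS]mulrA divff ?gt_eqF// mul1r.
  apply: le_trans H; rewrite yE.
  have -> : f (y t) / 4 * Z - n%:R * l ^- 2 * (y t * Z) =
      Z * (f (y t) / 4 - n%:R * y t / l ^+ 2) by ring.
  rewrite ler_pM2l//.
  have : n%:R * y t / l ^+ 2 <= f (y t) / 8.
    by rewrite ler_pdivrMr ?exprn_gt0//; have := fl _ cy; lra.
  by lra.
- by rewrite /y mulrC ler_pdivlMr.
Qed.

(** * Recovering a plateau of the initial function *)

Lemma measurable_eball (R : realType) (n : nat) (p : 'rV[R]_n) (rho : R) :
  0 < rho -> measurable (eball p rho).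
Proof.
move=> rho0.
rewrite (_ : eball p rho = setT `&`
    (fun x => enorm (x - p) ^+ 2) @^-1` `]-oo, rho ^+ 2[%classic).
  have mf : measurable_fun setT (fun x : 'rV[R]_n => enorm (x - p) ^+ 2).
    exact: (measurableT_comp (@measurable_enormB R n) (pair2_measurable _)).
  by apply: mf => //; exact: measurable_itv.
rewrite setTI; apply/seteqP; split => x; rewrite /eball /= in_itv/=.
  by move=> H; rewrite ltr_pXn2r// nnegrE ?enorm_ge0// ltW.
by rewrite ltr_pXn2r// nnegrE ?enorm_ge0// ltW.
Qed.

Lemma measurable_heat_error (R : realType) (n : nat) (t : R) (u0 : 'rV[R]_n -> R)
    (u : R -> 'rV[R]_n -> R) :
  (forall x, 0 <= u0 x) -> measurable_fun setT u0 -> continuous (u t) ->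
  measurable_fun setT (heat_error u u0 t).
Proof.
move=> u00 mu0 cu; apply: emeasurable_funB.
  by apply/measurable_EFinP; exact: continuous_measurable_rV.
exact: measurable_heat.
Qed.

(** Convergence of [g t] to [0] in measure on [Q] as [t] tends to [0] from the
    right, stated with subsets of the sets where [g t] is large.  It is
    the common consequence of the two senses in which the initial condition may
    be understood. *)
Definition eventually_small (R : realType) (n : nat) (Q : set 'rV[R]_n)
    (g : R -> 'rV[R]_n -> \bar R) : Prop :=
  forall k e : R, 0 < k -> 0 < e -> \forall t \near 0^'+,
    forall B : set 'rV[R]_n, measurable B -> B `<=` Q ->
      (forall x, B x -> (k%:E <= `|g t x|)%E) -> (lebesgue_rV R n B <= e%:E)%E.

Lemma le_poweR (R : realType) (q : R) (a b : \bar R) : 0 <= q ->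
  (0 <= a)%E -> (a <= b)%E -> (a `^ q <= b `^ q)%E.
Proof.
move=> q0 a0 ab; apply: gt0_ler_poweR => //; rewrite in_itv/= leey andbT//.
exact: le_trans ab.
Qed.

(** Markov's inequality on the ball centred at [p]. *)
Lemma eventually_small_ul (R : realType) (n : nat) (p : 'rV[R]_n) (rho q T : R)
    (g : R -> 'rV[R]_n -> \bar R) : 0 < rho -> 0 < q -> 0 < T ->
  (forall t, 0 < t < T -> measurable_fun setT (g t)) ->
  ul_norm rho q (g t) @[t --> 0^'+] --> 0%E ->
  eventually_small (eball p rho) g.
Proof.
move=> rho0 q0 T0 mg glim k e k0 e0.
have kq0 : 0 < k `^ q by rewrite powR_gt0.
(* A set of measure [e] on which the function is at least [k] forces the norm
   to be at least [d]. *)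
pose d := ((k `^ q * e) `^ q^-1)%R.
have d0 : 0 < d by rewrite powR_gt0// mulr_gt0.
have nb : nbhs (0 : \bar R)%E [set z | (z < d%:E)%E].
  by apply: open_nbhs_nbhs; split; [exact: open_ereal_lt_ereal|rewrite /= lte_fin].
have Hn := glim _ nb.
near=> t => B mB BQ Bk.
have tT : 0 < t < T.
  apply/andP; split; near: t; [exact: nbhs_right_gt|exact: nbhs_right_lt].
have H : (ul_norm rho q (g t) < d%:E)%E by near: t; exact: Hn.
rewrite leNgt; apply/negP => eB; move: H; apply/negP; rewrite -leNgt.
have mgq D : measurable_fun D (fun x => (`|g t x| `^ q)%E).
  apply: measurable_funTS; apply: (measurableT_comp (measurable_poweR q)).
  by apply: measurableT_comp => //; exact: mg.
have gq0 x : (0 <= `|g t x| `^ q)%E by exact: poweR_ge0.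
have mE := measurable_eball p rho0.
have I1 : ((k `^ q * e)%:E <= \int[lebesgue_rV R n]_(x in eball p rho) (`|g t x| `^ q))%E.
  apply: (@le_trans _ _ (\int[lebesgue_rV R n]_(x in B) (`|g t x| `^ q))%E); last first.
    exact: ge0_subset_integral.
  apply: (@le_trans _ _ (\int[lebesgue_rV R n]_(x in B) (k `^ q)%:E)%E).
    rewrite integral_cst// EFinM lee_pmul2l ?lte_fin//; exact: ltW.
  apply: ge0_le_integral => //.
  - by move=> x _; rewrite lee_fin ltW.
  - by move=> x /Bk kx; rewrite -poweR_EFin; apply: le_poweR => //; rewrite ?lee_fin; exact: ltW.
apply: (@le_trans _ _ ((\int[lebesgue_rV R n]_(x in eball p rho) (`|g t x| `^ q))
    `^ q^-1)%E).
  rewrite -poweR_EFin; apply: le_poweR => //.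
  - by rewrite invr_ge0 ltW.
  - by rewrite lee_fin mulr_ge0// ltW.
by apply: ereal_sup_ubound; exists p.
Unshelve. all: by end_near.
Qed.

Lemma eventually_small_Linfty (R : realType) (n : nat) (Q : set 'rV[R]_n)
    (g : R -> 'rV[R]_n -> \bar R) :
  Linfty_norm (g t) @[t --> 0^'+] --> 0%E -> eventually_small Q g.
Proof.
move=> glim k e k0 e0.
have nb : nbhs (0 : \bar R)%E [set z | (z < k%:E)%E].
  by apply: open_nbhs_nbhs; split; [exact: open_ereal_lt_ereal|rewrite /= lte_fin].
have Hn := glim _ nb.
near=> t => B mB BQ Bk.
have H : (Linfty_norm (g t) < k%:E)%E by near: t; exact: Hn.
have muT : (0 < lebesgue_rV R n setT)%E.
  have H1 : (0 < lebesgue_rV R n [set x : 'rV[R]_n | `|x - 0| < 1]%R)%E.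
    by rewrite lebesgue_rV_ball// lte_fin exprn_gt0// mulr1.
  apply: (lt_le_trans H1); apply: le_measure; rewrite ?inE//.
  exact: measurable_rV_ball.
move: H; rewrite /Linfty_norm unlock muT => H.
have [N [mN N0 sub]] := ess_sup_ge (lebesgue_rV R n) (abse \o g t).
have BN : B `<=` N.
  move=> x Bx; apply: sub => /= le1.
  by have := le_lt_trans (le_trans (Bk x Bx) le1) H; rewrite ltxx.
rewrite (@le_trans _ _ (lebesgue_rV R n N))//.
  by apply: le_measure => //; rewrite inE.
by rewrite [X in (X <= _)%E]N0 lee_fin ltW.
Unshelve. all: by end_near.
Qed.

(** On the support of the weight, [heat t u0] is at least [c + eta / 2] for
    small [t], by [heat_ge] in the gap of width [d] between the support and the
    complement of the cube.  So [u t] is below [c + eta / 4] only where the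
    error is at least [eta / 4], a set of small measure, which lowers the mean
    by less than what the margin [eta / 4] provides. *)
Lemma initial_mean_ge (R : realType) (n : nat) (p : 'rV[R]_n) (l T c eta : R)
    (Q : set 'rV[R]_n) (u0 : 'rV[R]_n -> R) (u : R -> 'rV[R]_n -> R) :
  0 < l -> 0 < T -> 0 < c -> 0 < eta ->
  (forall x, 0 <= u0 x) -> measurable_fun setT u0 ->
  (forall x, `|x - p| < 2 * l -> c + eta <= u0 x) ->
  (forall t, 0 < t < T -> continuous (u t)) ->
  (forall t x, 0 < t < T -> 0 <= u t x) ->
  [set x | `|x - p| < 2 * l] `<=` Q ->
  eventually_small Q (heat_error u u0) ->
  exists2 t1, 0 < t1 < T & c * bumpI p l (fun=> 1) <= bumpI p l (u t1).
Proof.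
move=> l0 T0 c0 eta0 u00 mu0 u0v cu u_ge0 subQ small.
have Z0 := bumpI1_gt0 p l0; set Z := bumpI p l (fun=> 1) in Z0 *.
pose k := eta / 4; have k0 : 0 < k by rewrite divr_gt0.
have ck0 : 0 < c + k by rewrite addr_gt0.
(* The largest measure for which [(c + k) * (Z - e) >= c * Z]. *)
pose e := Z * k / (c + k); have e0 : 0 < e by rewrite divr_gt0// mulr_gt0.
pose d := (2 - pi / 2) * l.
have d0 : 0 < d by rewrite mulr_gt0// subr_gt0 pihalf_lt2.
pose v := c + eta; have v0 : 0 < v by rewrite addr_gt0.
pose K := v * (2 `^ (n%:R / 2) * (8 / d ^+ 2)).
have K0 : 0 < K by rewrite mulr_gt0// mulr_gt0 ?powR_gt0// divr_gt0// exprn_gt0.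
have tau0 : 0 < Num.min T (2 * k / K) by rewrite lt_min T0 divr_gt0// mulr_gt0.
have [t [t0 tT tK sm]] : exists t, [/\ 0 < t, t < T, t < 2 * k / K &
    forall B : set 'rV[R]_n, measurable B -> B `<=` Q ->
      (forall x, B x -> (k%:E <= `|heat_error u u0 t x|)%E) ->
      (lebesgue_rV R n B <= e%:E)%E].
  suff : \forall t \near 0^'+, [/\ 0 < t, t < T, t < 2 * k / K &
      forall B : set 'rV[R]_n, measurable B -> B `<=` Q ->
      (forall x, B x -> (k%:E <= `|heat_error u u0 t x|)%E) ->
      (lebesgue_rV R n B <= e%:E)%E] by move=> /filter_ex.
  near=> t; split; near: t.
  - exact: nbhs_right_gt.
  - exact: nbhs_right_lt.
  - by apply: nbhs_right_lt; rewrite divr_gt0// mulr_gt0.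
  - exact: small.
have tT' : 0 < t < T by rewrite t0.
exists t => //.
pose B := [set x | `|x - p| < 2 * l] `&` [set x | cubebump p l x != 0] `&`
  [set x | u t x < c + k].
have mB : measurable B.
  apply: measurableI; first apply: measurableI.
  - exact: measurable_rV_ball.
  - rewrite (_ : mkset _ = setT `&` cubebump p l @^-1` [set~ 0]).
      apply: (@measurable_cubebump R n p l) => //.
      by apply: measurableC; exact: measurable_set1.
    by rewrite setTI; apply/seteqP; split => x /=; [move/eqP|move=> ?; apply/eqP].
  - rewrite (_ : mkset _ = setT `&` u t @^-1` `]-oo, c + k[%classic).
      by apply: (continuous_measurable_rV (cu t tT')) => //; exact: measurable_itv.
    by rewrite setTI; apply/seteqP; split => x /=; rewrite in_itv.
have muB : (lebesgue_rV R n B <= e%:E)%E.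
  apply: sm => //; first by move=> x [[xQ _] _]; exact: subQ.
  move=> x [[_ /= x0] ux].
  have hx : ((c + 2 * k)%:E <= heat t u0 x)%E.
    apply: le_trans (@heat_ge R n t d v u0 x u00 mu0 t0 d0 (ltW v0) _).
      have -> : v * (1 - 2 `^ (n%:R / 2) * (8 * t / d ^+ 2)) = v - K * t.
        by rewrite /K; ring.
      have : t * K < 2 * k by rewrite -ltr_pdivlMr.
      by rewrite lee_fin /v /k; lra.
    move=> y xy; apply: u0v; rewrite rV_norm_lt ?mulr_gt0//.
    apply/forallP => i; rewrite !mxE.
    have := cubebump_neq0 i l0 x0; have := le_lt_trans (le_coord_enorm _ i) xy.
    rewrite !mxE => H1 H2.
    have -> : y ord0 i - p ord0 i = (x ord0 i - p ord0 i) - (x ord0 i - y ord0 i).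
      by ring.
    by rewrite (le_lt_trans (ler_normB _ _))//; move: H1 H2; rewrite /d; lra.
  rewrite /heat_error.
  case: (heat t u0 x) hx => [h hx|_|]; last by rewrite leeNy_eq.
    by move: hx; rewrite -EFinB /= !lee_fin => hx; rewrite ler0_norm; move: ux => /=; lra.
  by rewrite /= leey.
have c1 : continuous ((fun=> 1) : 'rV[R]_n -> R) by exact: cst_continuous.
have cut := cu t tT'.
have H : ((c + k) * Z <= bumpI p l (u t) + (c + k) * e).
  rewrite -lee_fin EFinD [leLHS]EFinM [X in (_ <= _ + X)%E]EFinM.
  have intE (g : 'rV[R]_n -> R) : continuous g ->
      ((bumpI p l g)%:E = \int[lebesgue_rV R n]_x (g x * cubebump p l x)%:E)%E.
    move=> cg; rewrite /bumpI /Rintegral fineK//.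
    by apply: integrable_fin_num => //; exact: bump_integrable.
  rewrite /Z !intE//.
  have mg (g : 'rV[R]_n -> R) : continuous g ->
      measurable_fun setT (fun x => (g x * cubebump p l x)%:E).
    move=> cg; apply/measurable_EFinP; apply: measurable_funM.
      exact: continuous_measurable_rV.
    exact: measurable_cubebump.
  rewrite -ge0_integralZl_EFin//; last 3 first.
  - by move=> x _; rewrite lee_fin mul1r cubebump_ge0.
  - exact: mg.
  - exact: ltW.
  have mI : measurable_fun setT (fun x => ((c + k)%:E * (\1_B x)%:E)%E).
    by apply: measurable_funeM; apply/measurable_EFinP; exact: measurable_indic.
  apply: (@le_trans _ _ (\int[lebesgue_rV R n]_x
      ((u t x * cubebump p l x)%:E + (c + k)%:E * (\1_B x)%:E))%E).
    apply: ge0_le_integral => //.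
    - move=> x _; rewrite -EFinM lee_fin mul1r.
      by rewrite mulr_ge0 ?cubebump_ge0 ?(ltW ck0).
    - by apply: measurable_funeM; exact: mg.
    - by apply: emeasurable_funD => //; exact: mg.
    - move=> x _; rewrite -!EFinM -EFinD lee_fin mul1r.
      have ph0 := cubebump_ge0 p l x.
      have uph : 0 <= u t x * cubebump p l x by rewrite mulr_ge0// u_ge0.
      have [xB|xB] := pselect (B x).
        rewrite indicE mem_set// mulr1 ler_wpDl// ler_piMr ?(ltW ck0)//.
        exact: cubebump_le1.
      rewrite indicE memNset// mulr0 addr0.
      have [->|x0] := eqVneq (cubebump p l x) 0; first by rewrite !mulr0.
      rewrite ler_wpM2r// leNgt; apply/negP => ux; apply: xB; split => //.
      split => //=; apply: contrapT => xQ.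
      by move: x0; rewrite cubebump_eq0 ?eqxx.
  rewrite ge0_integralD//; last 3 first.
  - by move=> x _; rewrite lee_fin mulr_ge0 ?cubebump_ge0 ?u_ge0.
  - exact: mg.
  - by move=> x _; rewrite -EFinM lee_fin mulr_ge0// ltW.
  rewrite leeD2l// ge0_integralZl_EFin//; last first.
  - exact: ltW.
  - by apply/measurable_EFinP; exact: measurable_indic.
  rewrite integral_indic// setIT; apply: lee_wpmul2l; last exact: muB.
  by rewrite lee_fin ltW.
have E2 : (c + k) * e = Z * k by rewrite /e mulrC divfK// gt_eqF.
by move: H; rewrite E2; lra.
Unshelve. all: by end_near.
Qed.

(** * Functions constant on countably many pieces *)

(** [0] outside all pieces and [k.+1] on the [k]-th one, so that any function
    constant on each piece and on their complement factors through the discrete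
    space [nat], which settles its measurability. *)
Definition piece_index (T : Type) (Q : nat -> set T) (x : T) : nat :=
  if pselect (exists k, Q k x) is left ex then (sval (cid ex)).+1 else 0%N.

Lemma piece_indexE (T : Type) (Q : nat -> set T) (k : nat) (x : T) :
  (forall i j x, Q i x -> Q j x -> i = j) -> Q k x -> piece_index Q x = k.+1.
Proof.
move=> dis Qk; rewrite /piece_index; case: pselect => [ex|]; last by case; exists k.
by congr _.+1; apply: dis (svalP (cid ex)) Qk.
Qed.

Lemma piece_index_succ (T : Type) (Q : nat -> set T) (k : nat) (x : T) :
  piece_index Q x = k.+1 -> Q k x.
Proof.
rewrite /piece_index; case: pselect => // ex [<-]; exact: (svalP (cid ex)).
Qed.

Lemma measurable_piece_index (d : measure_display) (T : measurableType d)
    (Q : nat -> set T) : (forall i j x, Q i x -> Q j x -> i = j) ->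
  (forall k, measurable (Q k)) -> measurable_fun setT (piece_index Q).
Proof.
move=> dis mQ _ Y _; rewrite setTI.
have E0 : piece_index Q @^-1` [set 0%N] = ~` \bigcup_k Q k.
  apply/seteqP; split => x /=.
    by move=> x0 [k _ /(piece_indexE dis)]; rewrite x0.
  rewrite /piece_index; case: pselect => // -[k Qk]; case; by exists k.
have ES k : piece_index Q @^-1` [set k.+1] = Q k.
  by apply/seteqP; split => x /=; [exact: piece_index_succ|exact: piece_indexE].
rewrite (_ : _ @^-1` Y = \bigcup_(k in Y) (piece_index Q @^-1` [set k])).
  apply: bigcup_measurable => -[|k] _; last by rewrite ES.
  by rewrite E0; apply: measurableC; exact: bigcupT_measurable.
by apply/seteqP; split => x /=; [move=> Yx; exists (piece_index Q x)|case=> k Yk /= ->].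
Qed.

(** Over a ball the function is dominated by the constant [C] plus the sum of
    the [a k] times the indicators of the pieces, whose integral over the whole
    space is at most [1 / 2 + 1 / 4 + ...]. *)
Lemma in_Lul1_pieces (R : realType) (n : nat) (rho C : R) (Q : nat -> set 'rV[R]_n)
    (a : nat -> R) (G : 'rV[R]_n -> \bar R) : 0 < rho -> 0 <= C ->
  (forall k, measurable (Q k)) -> measurable_fun setT G ->
  (forall x, (0 <= G x)%E) -> (forall k, 0 <= a k) ->
  (forall x, (G x <= C%:E)%E \/ exists2 k, Q k x & (G x <= (a k)%:E)%E) ->
  (forall k, ((a k)%:E * lebesgue_rV R n (Q k) <= (1 / (2 ^ k.+1)%:R)%:E)%E) ->
  in_Lul rho 1 G.
Proof.
move=> rho0 C0 mQ mG G0 a0 GCa aQ; split=> //.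
apply: (@le_lt_trans _ _ (C * (2 * rho) ^+ n + 1)%:E); last exact: ltry.
apply: ge_ereal_sup => _ [y _ <-].
rewrite invr1 poweRe1; last by apply: integral_ge0 => x _; exact: poweR_ge0.
have mE := measurable_eball y rho0.
pose g k x : \bar R := ((a k)%:E * (\1_(Q k) x)%:E)%E.
have g0 k x : (0 <= g k x)%E by rewrite mule_ge0// lee_fin.
have mg k D : measurable_fun D (g k).
  apply: measurable_funeM; apply/measurable_EFinP; apply: measurable_funTS.
  exact: measurable_indic.
have mS D : measurable_fun D (fun x => \sum_(k <oo) g k x)%E.
  by apply: ge0_emeasurable_sum => // k x *; exact: g0.
have S0 x : (0 <= \sum_(k <oo) g k x)%E by apply: nneseries_ge0.
have GS x : (G x <= C%:E + \sum_(k <oo) g k x)%E.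
  have [GC|[k Qk Ga]] := GCa x; first by rewrite (le_trans GC)// leeDl.
  rewrite (le_trans Ga)// (@le_trans _ _ (\sum_(k <oo) g k x)%E)//; last first.
    by rewrite leeDr// lee_fin.
  apply: (@le_trans _ _ (\sum_(0 <= i < k.+1) g i x)%E); last first.
    by apply: nneseries_lim_ge.
  have <- : g k x = (a k)%:E by rewrite /g indicE mem_set// mule1.
  by rewrite big_nat_recr//= leeDr//; apply: sume_ge0 => i _.
rewrite (@le_trans _ _ (\int[lebesgue_rV R n]_(x in eball y rho)
   (C%:E + \sum_(k <oo) g k x))%E)//.
  apply: ge0_le_integral => //.
  - by move=> x _; exact: poweR_ge0.
  - apply: measurable_funTS; apply: (measurableT_comp (measurable_poweR 1)).
    exact: measurableT_comp.
  - by apply: emeasurable_funD => //; exact: measurable_cst.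
  - by move=> x _; rewrite poweRe1// gee0_abs.
rewrite ge0_integralD// EFinD leeD//.
  rewrite integral_cst// EFinM lee_wpmul2l ?lee_fin//.
  apply: (@le_trans _ _ (lebesgue_rV R n [set x | `|x - y| < rho]%R)).
    apply: le_measure; rewrite ?inE//; first exact: measurable_rV_ball.
    move=> x; rewrite /eball /= rV_norm_lt// => xy; apply/forallP => i.
    exact: le_lt_trans (le_coord_enorm _ i) xy.
  by rewrite lebesgue_rV_ball.
apply: (@le_trans _ _ (\int[lebesgue_rV R n]_x (\sum_(k <oo) g k x))%E).
  exact: ge0_subset_integral.
rewrite integral_nneseries//.
apply: le_trans (epsilon_trick0 xpredT ler01).
apply: lee_nneseries => [k _ _|k _]; first by apply: integral_ge0.
rewrite ge0_integralZl_EFin//.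
- by rewrite integral_indic// setIT; exact: aQ.
- by apply/measurable_EFinP; exact: measurable_indic.
Qed.

(** * The initial function without a solution *)

Lemma powR_small (R : realType) (a e : R) : 0 < a -> 0 < e ->
  exists2 d : R, 0 < d & forall x, 0 <= x -> x < d -> x `^ a < e.
Proof.
move=> a0 e0; exists (e `^ a^-1) => [|x x0 xd]; first by rewrite powR_gt0.
have <- : (e `^ a^-1) `^ a = e by rewrite -powRrM mulVf ?gt_eqF// powRr1// ltW.
by apply: gt0_ltr_powR; rewrite ?nnegrE ?powR_ge0.
Qed.

Lemma F_negpowE (R : realType) (f : R -> R) (r s : R) :
  F_tail f s = (Ftail f s)%:E -> 0 < Ftail f s ->
  F_negpow f r s = ((Ftail f s `^ r)^-1)%:E.
Proof.
move=> E F0; rewrite /F_negpow E poweR_EFin inver ifF//.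
by rewrite gt_eqF// powR_gt0.
Qed.

Section construction.
Context {R : realType}.
Variables (N : nat) (rho : R) (f : R -> R) (A r : R).
Hypotheses (N_ge1 : (1 <= N)%N) (rho_gt0 : 0 < rho).
Hypothesis f_C1 : C1_halfline f.
Hypothesis f_gt0 : forall s, 0 < s -> 0 < f s.
Hypothesis df_gt0 : forall s, 0 < s -> 0 < derive1 f s.
Hypothesis F_fin : forall s, 0 < s -> (F_tail f s < +oo)%E.
Hypothesis A_lim : ((derive1 f s)%:E * F_tail f s)%E @[s --> +oo] --> A%:E.
Hypothesis A_below : exists2 s2 : R, 0 < s2 &
     forall s, s2 <= s -> (A%:E <= (derive1 f s)%:E * F_tail f s)%E.
Hypothesis A_ge1 : 1 <= A.
Hypotheses (r_gt0 : 0 < r) (r_small : r < N%:R / 2).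

(** The tail integral at [0] may be infinite, in which case the value is
    [0]. *)
Lemma F_negpow0 : exists2 C : R, 0 <= C & F_negpow f r 0 = C%:E.
Proof.
have F01 : (F_tail f 1 <= F_tail f 0)%E.
  apply: ge0_subset_integral => //.
  - exact: measurable_invf.
  - move=> x /=; rewrite in_itv/= andbT => x0.
    by rewrite lee_fin invr_ge0 ltW// f_gt0.
  - by move=> x /=; rewrite !in_itv/= !andbT; exact: lt_trans.
have F10 : (0 < F_tail f 1)%E.
  by rewrite F_tailE// lte_fin (Ftail_gt0 f_C1).
have := lt_le_trans F10 F01; rewrite /F_negpow.
case: (F_tail f 0) => [s|_|//].
  rewrite lte_fin => s0; exists ((s `^ r)^-1); first by rewrite invr_ge0 powR_ge0.
  by rewrite poweR_EFin inver ifF// gt_eqF// powR_gt0.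
by exists 0 => //; rewrite eqy_poweR.
Qed.

(** The midpoint of [2 * r / N] and [1]; [gam] is the margin by which it
    exceeds the former, up to the factor [N / 2]. *)
Let th : R := (2 * r / N%:R + 1) / 2.
Let gam : R := th * N%:R / 2 - r.

Let N_gt0 : 0 < N%:R :> R. Proof. by rewrite ltr0n. Qed.

Let th01 : 0 < th < 1.
Proof.
have : 2 * r / N%:R < 1 by rewrite ltr_pdivrMr//; have := r_small; lra.
have : 0 < 2 * r / N%:R by rewrite divr_gt0// mulr_gt0.
by rewrite /th; lra.
Qed.

Let gam_gt0 : 0 < gam.
Proof.
have -> : gam = N%:R / 4 - r / 2 by rewrite /gam /th; field; exact: lt0r_neq0.
by have := r_small; lra.
Qed.

(** Length scale of the cube attached to [c].  When [F c < 1], its square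
    [F c ^ th] exceeds the blow-up time [F c], so that diffusion through the
    cube is slow on that time scale. *)
Let len (c : R) := Ftail f c `^ (th / 2).

Let len_sqr (c : R) : len c ^+ 2 = Ftail f c `^ th.
Proof.
rewrite /len -powR_mulrn; last exact: powR_ge0.
by rewrite -powRrM divfK// pnatr_eq0.
Qed.

(** In order: the blow-up estimate applies above [c]; the lifespan tends to
    zero with [k]; the cube is disjoint from those around other integers; it
    fits in a ball of radius [rho]; its weight is summable ([plateau_weight]).
    All but the first say that [F c] is small. *)
Let plateau_ok (S : R) (k : nat) (c : R) := [/\ S <= c, Ftail f c < k.+1%:R^-1,
  2 * len c < 1 / 2, N%:R * (2 * len c) ^+ 2 < rho ^+ 2 &
  2 `^ r * 4 ^+ N * Ftail f c `^ gam <= 1 / (2 ^ k.+1)%:R].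

Lemma plateau_exists (S : R) (k : nat) : 0 < S -> exists c, plateau_ok S k c.
Proof.
move=> S0; have /andP[th0 th1] := th01.
pose lam := Num.min (1 / 4) (rho / (2 * (N%:R + 1))).
have lam0 : 0 < lam.
  by rewrite lt_min !divr_gt0// mulr_gt0// ltr_wpDr.
have th20 : 0 < th / 2 by rewrite divr_gt0.
have [d1 d10 H1] := powR_small th20 lam0.
pose M : R := 2 `^ r * 4 ^+ N; have M0 : 0 < M.
  by rewrite mulr_gt0 ?powR_gt0// exprn_gt0.
have k0 : 0 < (2 ^ k.+1)%:R :> R by rewrite ltr0n expn_gt0.
have e0 : 0 < 1 / (2 ^ k.+1)%:R / M by rewrite !divr_gt0.
have [d2 d20 H2] := powR_small gam_gt0 e0.
pose d := Num.min k.+1%:R^-1 (Num.min d1 d2).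
have d0 : 0 < d by rewrite !lt_min d10 d20 invr_gt0 ltr0n.
have [s s0 Hs] := Ftail_cvg0 f_C1 f_gt0 df_gt0 F_fin d0.
pose c := Num.max s S.
have c0 : 0 < c by rewrite lt_max s0.
have F0 := Ftail_gt0 f_C1 f_gt0 df_gt0 F_fin c0.
have : Ftail f c < d by apply: Hs; rewrite le_max lexx.
rewrite !lt_min => /and3P[Fk Fd1 Fd2].
have := H1 _ (ltW F0) Fd1; rewrite -/(len c) lt_min => /andP[l1 l2].
have len0 : 0 < len c by rewrite powR_gt0.
exists c; split => //.
- by rewrite le_max lexx orbT.
- lra.
- move: l2; rewrite ltr_pdivlMr; last by rewrite mulr_gt0// ltr_wpDr.
  move=> l2; have l3 : 2 * len c * (N%:R + 1) < rho by lra.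
  have l30 : 0 <= 2 * len c * (N%:R + 1) by rewrite !mulr_ge0 ?addr_ge0// ltW.
  apply: (@le_lt_trans _ _ ((2 * len c * (N%:R + 1)) ^+ 2)).
    set q := 2 * len c; rewrite [leRHS]exprMn [leLHS]mulrC ler_wpM2l ?sqr_ge0//.
    by have := N_gt0; rewrite expr2; nra.
  by rewrite ltr_pXn2r// nnegrE// ltW.
- by rewrite -/M mulrC -ler_pdivlMr// ltW// H2// ltW.
Qed.

(** The plateau is [c + eta c]: this increment leaves room above [c] and, by
    monotonicity of [f], at most halves the tail integral. *)
Let eta (c : R) := f c * Ftail f c / 2.

Lemma plateau_weight (S : R) (k : nat) (c : R) : 0 < S -> plateau_ok S k c ->
  (Ftail f (c + eta c) `^ r)^-1 * (2 * (2 * len c)) ^+ N <= 1 / (2 ^ k.+1)%:R.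
Proof.
move=> S0 [Sc _ _ _]; apply: le_trans.
have c0 : 0 < c by exact: lt_le_trans Sc.
have F0 := Ftail_gt0 f_C1 f_gt0 df_gt0 F_fin c0.
have fc0 := f_gt0 c0.
have eta0 : 0 < eta c by rewrite divr_gt0// mulr_gt0.
have cc : c < c + eta c by rewrite ltrDl.
have v0 : 0 < c + eta c by rewrite addr_gt0.
have Fv0 := Ftail_gt0 f_C1 f_gt0 df_gt0 F_fin v0.
have Fv : Ftail f c / 2 <= Ftail f (c + eta c).
  have /andP[_] := Ftail_diff f_C1 f_gt0 df_gt0 F_fin c0 cc.
  have -> : (c + eta c - c) / f c = Ftail f c / 2.
    by rewrite /eta; field; exact: lt0r_neq0.
  by lra.
have lenN : len c ^+ N = Ftail f c `^ (th * N%:R / 2).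
  rewrite /len -powR_mulrn ?powR_ge0// -powRrM; congr (_ `^ _).
  by field.
have inv : (Ftail f (c + eta c) `^ r)^-1 <= 2 `^ r * (Ftail f c `^ r)^-1.
  rewrite -[2 `^ r]invrK -invfM lef_pV2 ?posrE; last 2 first.
  - by rewrite powR_gt0.
  - by rewrite mulr_gt0// ?invr_gt0 powR_gt0.
  have -> : (2 `^ r)^-1 * Ftail f c `^ r = (Ftail f c / 2) `^ r.
    rewrite powRM ?invr_ge0// ?ltW// mulrC; congr (_ * _).
    by rewrite -(@powR_inv1 _ 2)// -powRrM mulN1r powRN.
  by apply: ge0_ler_powR; rewrite ?nnegrE ?divr_ge0 ?(ltW F0) ?(ltW Fv0) ?(ltW r_gt0).
have -> : (2 * (2 * len c)) ^+ N = 4 ^+ N * Ftail f c `^ (th * N%:R / 2).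
  by rewrite -lenN -exprMn; congr (_ ^+ _); ring.
rewrite /gam powRB; last by rewrite (gt_eqF F0) implybT.
have P0 : 0 <= 4 ^+ N * Ftail f c `^ (th * N%:R / 2).
  by rewrite mulr_ge0// ?powR_ge0// exprn_ge0.
apply: (le_trans (ler_wpM2r P0 inv)); rewrite le_eqVlt; apply/orP; left.
by apply/eqP; ring.
Qed.

(** The [k]-th cube is centred at the point all of whose coordinates are [k];
    [u0] is [c k + eta (c k)] on it and [0] elsewhere. *)
Lemma nonexistence_construction :
  exists u0 : 'rV[R]_N -> R,
    [/\ forall x, 0 <= u0 x,
        measurable_fun setT u0,
        in_Lul rho 1 (fun x => F_negpow f r (u0 x)) &
        forall (T : R) (u : R -> 'rV[R]_N -> R), 0 < T ->
          nonneg_classical_solution f T u ->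
          (forall p, eventually_small (eball p rho) (heat_error u u0)) -> False].
Proof.
have [S1 S10 HS1] := supporting_line f_C1 f_gt0 df_gt0 F_fin A_ge1 A_lim A_below.
have N80 : 0 <= 8 * N%:R :> R by rewrite mulr_ge0.
have [S2 S20 HS2] := fF_superlinear f_C1 f_gt0 df_gt0 F_fin A_ge1 A_lim A_below
  th01 N80.
pose S := Num.max S1 S2; have S0 : 0 < S by rewrite lt_max S10.
have [c cP] := choice (fun k => plateau_exists k S0).
have c0 k : 0 < c k by have [Sc _ _ _ _] := cP k; exact: lt_le_trans Sc.
have F0 k := Ftail_gt0 f_C1 f_gt0 df_gt0 F_fin (c0 k).
have l0 k : 0 < len (c k) by rewrite powR_gt0.
have eta0 k : 0 < eta (c k) by rewrite divr_gt0// mulr_gt0 ?f_gt0.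
pose v k := c k + eta (c k).
have v0 k : 0 < v k by rewrite addr_gt0.
have Fv0 k := Ftail_gt0 f_C1 f_gt0 df_gt0 F_fin (v0 k).
pose p k : 'rV[R]_N := const_mx k%:R.
pose Q k := [set x : 'rV[R]_N | `|x - p k| < 2 * len (c k)].
have mQ k : measurable (Q k) by exact: measurable_rV_ball.
have dis i j x : Q i x -> Q j x -> i = j.
  have aux k : Q k x -> `|x ord0 (Ordinal N_ge1) - k%:R| < 1 / 2.
    rewrite /Q/= rV_norm_lt ?mulr_gt0// => /forallP/(_ (Ordinal N_ge1)).
    rewrite !mxE => /lt_trans; apply; by have [] := cP k.
  move=> /aux; rewrite ltr_distl => Hi /aux; rewrite ltr_distl => Hj.
  have [ij|ij|//] := ltngtP i j.
    have : i.+1%:R <= j%:R :> R by rewrite ler_nat.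
    by rewrite -natr1 => H; exfalso; lra.
  have : j.+1%:R <= i%:R :> R by rewrite ler_nat.
  by rewrite -natr1 => H; exfalso; lra.
pose V (m : nat) : R := if m is k.+1 then v k else 0.
pose u0 x := V (piece_index Q x).
have u0Q k x : Q k x -> u0 x = v k by move=> /(piece_indexE dis) E; rewrite /u0 E.
have mV d (U : measurableType d) (h : nat -> U) :
    measurable_fun setT (h \o piece_index Q).
  by apply: measurableT_comp => //; exact: measurable_piece_index.
have u0_ge0 x : 0 <= u0 x.
  by rewrite /u0; case: piece_index => [|k] //=; exact: ltW.
have mu0 : measurable_fun setT u0 by exact: mV.
exists u0; split => //.
- have [C C0 CE] := F_negpow0.
  pose a k := (Ftail f (v k) `^ r)^-1.
  have aE k : F_negpow f r (v k) = (a k)%:E.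
    by apply: F_negpowE => //; exact: F_tailE.
  apply: (@in_Lul1_pieces R N rho C Q a) => //.
  - exact: (mV _ _ (fun m => F_negpow f r (V m))).
  - move=> x; rewrite /u0; case: piece_index => [|k] /=; first by rewrite CE lee_fin.
    by rewrite aE lee_fin invr_ge0 powR_ge0.
  - by move=> k; rewrite invr_ge0 powR_ge0.
  - move=> x; rewrite /u0; case E : (piece_index Q x) => [|k] /=.
      by left; rewrite CE.
    by right; exists k; [exact: piece_index_succ E|rewrite aE].
  - move=> k; rewrite lebesgue_rV_ball ?mulr_gt0// -EFinM lee_fin.
    exact: plateau_weight S0 (cP k).
- move=> T u T0 sol small.
  have [[_ [cu _ _ _]] u_ge0 _] := sol.
  (* A lifespan of [T / 4] counted from some [t1 < T / 4] exceeds the bound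
     [8 * F (c k)]. *)
  pose k := Num.truncn (32 / T).
  have kT : 8 * k.+1%:R^-1 < T / 4.
    have : 32 / T < k.+1%:R by exact: truncnS_gt.
    rewrite ltr_pdivrMr// => H; rewrite ltr_pdivrMr ?ltr0n//; lra.
  have [Sc Fk _ ballk _] := cP k.
  have T40 : 0 < T / 4 by rewrite divr_gt0.
  have inT t : 0 < t < T / 4 -> 0 < t < T.
    by move=> /andP[t0 tT]; rewrite t0; lra.
  have [| | | | |t1 /andP[t10 t1T] It1] := @initial_mean_ge R N (p k) (len (c k)) (T / 4)
    (c k) (eta (c k)) (eball (p k) rho) u0 u (l0 k) T40 (c0 k) (eta0 k) u0_ge0 mu0.
  + by move=> x xQ; rewrite (u0Q k).
  + by move=> t /inT tT; exact: (continuous_slice cu tT).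
  + by move=> t x /inT tT; exact: u_ge0.
  + move=> x; rewrite /= rV_norm_lt ?mulr_gt0// => /forallP xQ.
    rewrite /eball/=; apply: enorm_lt ballk => // i; apply: ltW; exact: xQ.
  + exact: small.
  have := @solution_lifespan_le R N f (fun y => A / Ftail f y) T t1 (T / 2)
    (len (c k)) (c k) (p k) u f_C1 f_gt0 df_gt0 F_fin.
  have t12 : t1 < T / 2 by lra.
  have t2T : T / 2 < T by lra.
  have sup y s : c k <= y -> 0 <= s ->
      f y / 4 + A / Ftail f y * (s - y) <= f s.
    move=> cy s0; apply: HS1 => //; apply: le_trans cy; apply: le_trans Sc.
    by rewrite le_max lexx.
  have large y : c k <= y -> 8 * N%:R * y <= f y * len (c k) ^+ 2.
    move=> cy; have y0 := lt_le_trans (c0 k) cy.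
    have yS : S2 <= y.
      by apply: le_trans cy; apply: le_trans Sc; rewrite le_max lexx orbT.
    apply: (le_trans (HS2 y yS)); rewrite ler_wpM2l ?(ltW (f_gt0 y0))//.
    rewrite len_sqr.
    have /andP[th0 _] := th01.
    have Fy := Ftail_gt0 f_C1 f_gt0 df_gt0 F_fin y0.
    apply: ge0_ler_powR; rewrite ?nnegrE ?(ltW th0) ?(ltW Fy) ?(ltW (F0 k))//.
    exact: (Ftail_le f_C1).
  move=> /(_ sup (c0 k) (l0 k) large sol t10 t12 t2T It1) H.
  have : 8 * Ftail f (c k) < 8 * k.+1%:R^-1 by rewrite ltr_pM2l.
  move=> H1; have := le_lt_trans H (lt_trans H1 kT).
  lra.
Qed.

End construction.

Theorem theorem1p2 (R : realType) (N : nat) (rho : R) (f : R -> R) (A r : R)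
  (N_ge1 : (1 <= N)%N) (rho_gt0 : 0 < rho)
  (f_C1 : C1_halfline f)
  (f_gt0 : forall s, 0 < s -> 0 < f s)
  (df_gt0 : forall s, 0 < s -> 0 < derive1 f s)
  (F_fin : forall s, 0 < s -> (F_tail f s < +oo)%E)
  (A_lim : ((derive1 f s)%:E * F_tail f s)%E @[s --> +oo] --> A%:E)
  (A_small : A - 1 < N%:R / 2)
  (A_below : exists2 s2 : R, 0 < s2 &
     forall s, s2 <= s -> (A%:E <= (derive1 f s)%:E * F_tail f s)%E)
  (r_range : (1 < A /\ A - 1 <= r < N%:R / 2) \/ (A = 1 /\ 0 < r < N%:R / 2)) :
  exists u0 : 'rV[R]_N -> R,
    [/\ forall x, 0 <= u0 x,
        measurable_fun setT u0,
        in_Lul rho 1 (fun x => F_negpow f r (u0 x)) &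
        forall T : R, 0 < T ->
          ~ exists u : R -> 'rV[R]_N -> R,
              [/\ nonneg_classical_solution f T u,
                  1 < A -> ul_norm rho (r / (A - 1)) (heat_error u u0 t)
                             @[t --> 0^'+] --> 0%E &
                  A = 1 -> Linfty_norm (heat_error u u0 t)
                             @[t --> 0^'+] --> 0%E]].
Proof.
have [A_ge1 r_gt0 r_small] : [/\ 1 <= A, 0 < r & r < N%:R / 2].
  case: r_range => [[A1 /andP[Ar rN]]|[-> /andP[r0 rN]]]; split => //; first exact: ltW.
  by apply: lt_le_trans Ar; rewrite subr_gt0.
have [u0 [u0_ge0 mu0 u0L none]] := nonexistence_construction N_ge1 rho_gt0 f_C1
  f_gt0 df_gt0 F_fin A_lim A_below A_ge1 r_gt0 r_small.
exists u0; split=> // T T0 [u [sol lim_gt lim_eq]].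
apply: (none T u T0 sol) => p.
case: r_range => [[A1 _]|[A1 _]]; last exact: eventually_small_Linfty (lim_eq A1).
apply: (@eventually_small_ul R N p rho (r / (A - 1)) T) => //.
- by rewrite divr_gt0// subr_gt0.
- move=> t tT; apply: measurable_heat_error => //.
  by have [[_ [cu _ _ _]] _ _] := sol; exact: (continuous_slice cu tT).
- exact: lim_gt.
Qed.
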